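(* Let $q\in\kappa$ be generic for $\Gamma$ and let $(V,\rho)$ be a finite dimensional representation of $H_q(\Gamma)$. Then its quiver data $\Psi_\rho=(V_i,A^i_j)$ is an $H$-representation of type $(\Gamma;q)$. Furthermore, $V=(V_i+V_j)\oplus(V_i^0\cap V_j^0)$ for all $i\ne j\in I$.
   Context: $I$ is a finite set, $\Gamma=[m_{i,j}]_{i,j\in I}$ a Coxeter matrix ($m_{i,i}=1$, $m_{i,j}=m_{j,i}\ge2$ finite integers for $i\ne j$), $\kappa$ a field. The numbers $4\cos^2(a\pi/m)$, $m=m_{i,j}$, are regarded as elements of $\kappa$ (i.e. $2+\zeta^a+\zeta^{-a}$ with $\zeta$ a primitive $m$-th root of unity). $H_q(\Gamma)$ is the $\kappa$-algebra generated by $\sigma_i$ ($i\in I$) with relations $\sigma_i\sigma_j\cdots=\sigma_j\sigma_i\cdots$ ($m_{i,j}$ alternating factors on each side) for $i\neq j$, and $(\sigma_i-q)(\sigma_i+1)=0$. $q\in\kappa\setminus\{0\}$ is generic if the dihedral Hecke algebra $H_q(I_{m_{i,j}})$ (two generators, off-diagonal entry $m_{i,j}$) is semisimple for all $i\ne j$. Put $\lambda_{m;q}(a)=4\cos^2(a\pi/m)\frac{1}{q+q^{-1}+2}$. Quiver data: $V_i$, $V_i^0$ are the eigenspaces of $\rho(\sigma_i)$ for eigenvalues $q$, $-1$, so $V=V_i\oplus V_i^0$; for $i\ne j$, $A^i_j:V_i\to V_j$ sends $v\in V_i$ to its $V_j$-component in $V=V_j\oplus V_j^0$. $\Psi_\rho$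 is the family $(V_i,A^i_j)$. $(m;q)$-couple: for linear $f:V\to W$, $g:W\to V$, $(f,g)$ is an $(m;q)$-couple between $V$ and $W$ if $gf$, $fg$ are diagonalizable with eigenvalues in $\{1\}\cup\{\lambda_{m;q}(a):1\le a\le[\frac{m-1}{2}]\}$ when $m$ is odd; for $m$ even the eigenvalue $0$ is also allowed, and then it is required that $gf(x)=0\Rightarrow f(x)=0$ and $fg(y)=0\Rightarrow g(y)=0$. $H$-representation of type $(\Gamma;q)$: spaces $V_i$ ($i\in I$) and linear maps $A^i_j:V_i\to V_j$ ($i\ne j$) such that, with $V_{i,j}=\ker(A^j_iA^i_j-\mathrm{id})\subset V_i$: (a) $(A^i_j,A^j_i)$ is an $(m_{i,j};q)$-couple between $V_i$ and $V_j$ for all $i\ne j$; (b) $A^i_k(x)=A^j_kA^i_j(x)$ for distinct $i,j,k$ and $x\in V_{i,j}$; (c) $\mathrm{Im}(A^k_j-A^i_jA^k_i)\subset\mathrm{Im}(\mathrm{id}_{V_j}-A^i_jA^j_i)$ for distinct $i,j,k$. *)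

(* Defs.v *)
From HB Require Import structures.
From mathcomp Require Import all_boot all_order all_algebra all_field.
From mathcomp Require Import boolp.
From mathcomp Require Import monalg.

Set Implicit Arguments.
Unset Strict Implicit.
Unset Printing Implicit Defensive.

Import GRing.Theory.
Local Open Scope ring_scope.
Local Open Scope quotient_scope.

Definition coxeter_matrix (I : finType) (M : I -> I -> nat) : Prop :=
  [/\ forall i, M i i = 1%N, forall i j, M i j = M j i
    & forall i j, i != j -> (2 <= M i j)%N].

(* The free associative algebra on I; multinomials only provides the algebra
   axiom x * (a *: y) = a *: (x * y) when the monomials commute. *)
Definition free_algebra (R : comNzRingType) (I : choiceType) :=
  {malg R[{fmonom I}]}.

HB.instance Definition _ (R : comNzRingType) (I : choiceType) :=
  GRing.Lalgebra.on (free_algebra R I).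

Section FreeAlgebra.
Variables (R : comNzRingType) (I : choiceType).

Definition free_gen (i : I) : free_algebra R I := << fmu i >>.

Fact free_scalerAr (a : R) (x y : free_algebra R I) :
  a *: (x * y) = x * (a *: y).
Proof.
suff aC : (a%:MP : free_algebra R I) * x = x * a%:MP.
  by rewrite -(mul_malgC a (x * y)) -(mul_malgC a y) mulrA aC mulrA.
apply/malgP => k; pose d := msupp x.
rewrite (@mcoeffMlw _ _ (msupp (a%:MP : free_algebra R I)) d) //.
rewrite (@mcoeffMrw _ _ d (msupp (a%:MP : free_algebra R I))) //.
apply: eq_big_seq => m /= am; apply: eq_bigr => n _.
have -> : m = mone.
  move: am; rewrite -mcoeff_neq0 mcoeffC; case: (m == mone) / eqP => //=.
  by rewrite mulr0n eqxx.
by rewrite mul1m mulm1 mulrC.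
Qed.

HB.instance Definition _ :=
  GRing.Lalgebra_isAlgebra.Build R (free_algebra R I) free_scalerAr.

(* Evaluation at i |-> t for every i; only used to see that the algebras
   below are nonzero. *)
Let word_eval (t : R) (w : {fmonom I}) : R := t ^+ fdeg w.

Fact word_eval_mmorph t : mmorphism (word_eval t).
Proof. by split=> [x y|]; rewrite /word_eval ?fdegM ?exprD // fdeg1. Qed.

HB.instance Definition _ t :=
  isMultiplicative.Build _ R (word_eval t) (word_eval_mmorph t).

Definition free_eval (t : R) : free_algebra R I -> R :=
  mmap (@idfun R) (word_eval t).

HB.instance Definition _ t := GRing.RMorphism.copy (free_eval t)
  (mmap (@idfun R) (word_eval t)).

Lemma free_eval_gen t i : free_eval t (free_gen i) = t.
Proof. by rewrite /free_eval /free_gen mmapU /= mul1r /word_eval fdegU expr1. Qed.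

End FreeAlgebra.

Section Ideals.
Variable A : nzRingType.

Definition left_ideal (L : A -> Prop) : Prop :=
  [/\ L 0, forall x y, L x -> L y -> L (x + y) & forall a x, L x -> L (a * x)].

Definition two_sided_ideal (J : A -> Prop) : Prop :=
  left_ideal J /\ forall a x, J x -> J (x * a).

Definition ideal_gen (P : A -> Prop) (x : A) : Prop :=
  forall J, two_sided_ideal J -> (forall r, P r -> J r) -> J x.

Lemma ideal_gen_ideal P : two_sided_ideal (ideal_gen P).
Proof.
split; first split.
- by move=> J [[]].
- move=> x y hx hy J iJ hJ; case: (iJ) => [[_ add _] _].
  by apply: add; [apply: hx | apply: hy].
- move=> a x hx J iJ hJ; case: (iJ) => [[_ _ mul] _].
  by apply: mul; apply: hx.
- by move=> a x hx J iJ hJ; case: (iJ) => [_ mul]; apply: mul; apply: hx.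
Qed.

(* The left regular module is semisimple. *)
Definition semisimple_ring : Prop :=
  forall L, left_ideal L -> exists L',
    [/\ left_ideal L', forall x, L x -> L' x -> x = 0
      & forall x, exists y z, [/\ L y, L' z & x = y + z]].

End Ideals.

(* x * y * x * ... with n factors *)
Fixpoint alternating (A : nzRingType) (n : nat) (x y : A) : A :=
  if n is n'.+1 then x * alternating n' y x else 1.

Section Hecke.
Variables (k : fieldType) (I : finType) (q : k) (M : I -> I -> nat).

Local Notation F := (free_algebra k I).
Local Notation X := (@free_gen k I).

Inductive hecke_relator : F -> Prop :=
| hecke_braid_relator i j of i != j :
    hecke_relator (alternating (M i j) (X i) (X j)
                   - alternating (M i j) (X j) (X i))
| hecke_quadratic_relator i : hecke_relator ((X i - q%:A) * (X i + 1)).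

Definition hecke_ideal : {pred F} := fun x => `[< ideal_gen hecke_relator x >].

Fact hecke_ideal0 : 0 \in hecke_ideal.
Proof. by apply/asboolP; case: (ideal_gen_ideal hecke_relator) => -[]. Qed.

Fact hecke_idealD : {in hecke_ideal &, forall x y, x + y \in hecke_ideal}.
Proof.
move=> x y /asboolP hx /asboolP hy; apply/asboolP.
by case: (ideal_gen_ideal hecke_relator) => -[_ add _] _; apply: add.
Qed.

Fact hecke_idealMl a : {in hecke_ideal, forall x, a * x \in hecke_ideal}.
Proof.
move=> x /asboolP hx; apply/asboolP.
by case: (ideal_gen_ideal hecke_relator) => -[_ _ mul] _; apply: mul.
Qed.

Fact hecke_idealMr a : {in hecke_ideal, forall x, x * a \in hecke_ideal}.
Proof.
move=> x /asboolP hx; apply/asboolP.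
by case: (ideal_gen_ideal hecke_relator) => -[_ _ _] mul; apply: mul.
Qed.

Fact hecke_ideal_zmod_closed : zmod_closed hecke_ideal.
Proof.
split=> [|x y hx hy]; first exact: hecke_ideal0.
by rewrite hecke_idealD // -mulN1r hecke_idealMl.
Qed.

HB.instance Definition _ :=
  GRing.isZmodClosed.Build F hecke_ideal hecke_ideal_zmod_closed.

Fact hecke_ideal1 : 1 \notin hecke_ideal.
Proof.
pose ev : {rmorphism F -> k} := free_eval (-1).
have evX i : ev (X i) = -1 by apply: free_eval_gen.
have alt n i j : ev (alternating n (X i) (X j)) = (-1) ^+ n.
  elim: n i j => [|n IHn] i j /=; first by rewrite rmorph1.
  by rewrite rmorphM /= IHn evX exprS.
apply/asboolP => /(_ (fun x => ev x = 0)) h.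
suff : ev 1 = 0 by rewrite rmorph1 => /eqP; rewrite oner_eq0.
apply: h => [|_ [i j _|i]].
- split=> [|a x hx]; last by rewrite rmorphM /= hx mul0r.
  split=> [|x y hx hy|a x hx]; first exact: rmorph0.
    by rewrite rmorphD /= hx hy addr0.
  by rewrite rmorphM /= hx mulr0.
- by rewrite rmorphB /= !alt subrr.
- by rewrite rmorphM /= [ev (_ + 1)]rmorphD /= evX rmorph1 addNr mulr0.
Qed.

(* H_q(M): the free algebra modulo the ideal generated by the relators. *)
Definition hecke := Quotient.quot hecke_ideal.

HB.instance Definition _ := GRing.Zmodule.on hecke.

Definition hecke_pi (x : F) : hecke := \pi_(Quotient.quot hecke_ideal) x.
Local Notation pi := hecke_pi.

Fact hecke_reprK (x : hecke) : pi (repr x) = x.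
Proof. exact: reprK. Qed.

Definition hecke_one : hecke := pi 1.
Definition hecke_mul (x y : hecke) : hecke := pi (repr x * repr y).
Definition hecke_scale (a : k) (x : hecke) : hecke := pi (a *: repr x).

Fact hecke_eqP x y : reflect (pi x = pi y) (x - y \in hecke_ideal).
Proof. by rewrite Quotient.idealrBE; apply: eqP. Qed.

Fact hecke_piD x y : pi (x + y) = pi x + pi y.
Proof. by rewrite /hecke_pi !piE. Qed.

Fact hecke_piM x y : hecke_mul (pi x) (pi y) = pi (x * y).
Proof.
apply/esym/hecke_eqP.
rewrite -[x * y](addrNK (x * repr (pi y))) -mulrBr -addrA -mulrBl.
have repr_eq z : z - repr (pi z) \in hecke_ideal.
  by apply/hecke_eqP; rewrite hecke_reprK.
by apply: hecke_idealD; [apply: hecke_idealMl | apply: hecke_idealMr].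
Qed.

Fact hecke_piZ a x : hecke_scale a (pi x) = pi (a *: x).
Proof.
apply/hecke_eqP; rewrite -scalerBr -mulr_algl; apply: hecke_idealMl.
by apply/hecke_eqP; rewrite hecke_reprK.
Qed.

Fact hecke_mulA : associative hecke_mul.
Proof.
by move=> x y z; rewrite -[x]hecke_reprK -[y]hecke_reprK -[z]hecke_reprK !hecke_piM mulrA.
Qed.

Fact hecke_mul1r : left_id hecke_one hecke_mul.
Proof. by move=> x; rewrite -[x]hecke_reprK hecke_piM mul1r. Qed.

Fact hecke_mulr1 : right_id hecke_one hecke_mul.
Proof. by move=> x; rewrite -[x]hecke_reprK hecke_piM mulr1. Qed.

Fact hecke_mulDl : left_distributive hecke_mul +%R.
Proof.
move=> x y z; rewrite -[x]hecke_reprK -[y]hecke_reprK -[z]hecke_reprK.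
by rewrite -hecke_piD !hecke_piM mulrDl hecke_piD.
Qed.

Fact hecke_mulDr : right_distributive hecke_mul +%R.
Proof.
move=> x y z; rewrite -[x]hecke_reprK -[y]hecke_reprK -[z]hecke_reprK.
by rewrite -hecke_piD !hecke_piM mulrDr hecke_piD.
Qed.

Fact hecke_oner_neq0 : hecke_one != 0.
Proof.
have -> : 0 = pi 0 by rewrite /hecke_pi !piE.
by apply/eqP => /hecke_eqP; rewrite subr0 (negbTE hecke_ideal1).
Qed.

HB.instance Definition _ := GRing.Zmodule_isNzRing.Build hecke
  hecke_mulA hecke_mul1r hecke_mulr1 hecke_mulDl hecke_mulDr hecke_oner_neq0.

Fact hecke_scalerA a b x :
  hecke_scale a (hecke_scale b x) = hecke_scale (a * b) x.
Proof. by rewrite -[x]hecke_reprK !hecke_piZ scalerA. Qed.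

Fact hecke_scale1r : left_id 1 hecke_scale.
Proof. by move=> x; rewrite -[x]hecke_reprK hecke_piZ scale1r. Qed.

Fact hecke_scalerDr : right_distributive hecke_scale +%R.
Proof.
move=> a x y; rewrite -[x]hecke_reprK -[y]hecke_reprK -hecke_piD !hecke_piZ.
by rewrite scalerDr hecke_piD.
Qed.

Fact hecke_scalerDl x : {morph hecke_scale^~ x : a b / a + b}.
Proof. by move=> a b; rewrite -[x]hecke_reprK !hecke_piZ scalerDl hecke_piD. Qed.

HB.instance Definition _ := GRing.Zmodule_isLmodule.Build k hecke
  hecke_scalerA hecke_scale1r hecke_scalerDr hecke_scalerDl.

Fact hecke_scalerAl (a : k) (x y : hecke) : a *: (x * y) = a *: x * y.
Proof.
rewrite -[x]hecke_reprK -[y]hecke_reprK -![_ * _]/(hecke_mul _ _) -![_ *: _]/(hecke_scale _ _).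
by rewrite !(hecke_piM, hecke_piZ) scalerAl.
Qed.

HB.instance Definition _ := GRing.Lmodule_isLalgebra.Build k hecke
  hecke_scalerAl.

Fact hecke_scalerAr (a : k) (x y : hecke) : a *: (x * y) = x * (a *: y).
Proof.
rewrite -[x]hecke_reprK -[y]hecke_reprK -![_ * _]/(hecke_mul _ _) -![_ *: _]/(hecke_scale _ _).
by rewrite !(hecke_piM, hecke_piZ) scalerAr.
Qed.

HB.instance Definition _ := GRing.Lalgebra_isAlgebra.Build k hecke
  hecke_scalerAr.

Definition sigma (i : I) : hecke := pi (X i).

End Hecke.

(* Coxeter matrix of the dihedral type I_m, with bool as set of generators. *)
Definition dihedral (m : nat) (s t : bool) : nat := if s == t then 1 else m.

Definition generic (k : fieldType) (I : finType) (q : k) (M : I -> I -> nat) :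
    Prop :=
  q != 0 /\
  forall i j, i != j -> semisimple_ring (hecke q (dihedral (M i j))).

(* c a is 4 cos^2 (a pi / m) = 2 + z^a + z^-a as an element of k.  The root of
   unity z may live in an extension L of k.  It is a root of the cyclotomic
   polynomial 'Phi_m: this is the same as being a primitive m-th root of unity
   when m is nonzero in k (root_Cyclotomic below), and it also makes sense when
   the characteristic divides m (e.g. 4 cos^2 (pi / 3) = 1 in every field). *)
Definition four_cos_sq (k : fieldType) (m : nat) (c : nat -> k) : Prop :=
  exists (L : fieldType) (f : {rmorphism k -> L}) (z : L),
    root (map_poly intr (Cyclotomic m)) z /\
    forall a, f (c a) = 2 + z ^+ a + z ^- a.

Lemma root_Cyclotomic (L : fieldType) (m : nat) (z : L) :
  (m%:R : L) != 0 ->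
  root (map_poly intr (Cyclotomic m)) z = m.-primitive_root z.
Proof.
move=> nzm; have m_gt0 : (0 < m)%N by case: m nzm => //; rewrite eqxx.
pose P d : {poly L} := map_poly intr (Cyclotomic d).
have prodP n : (0 < n)%N -> \prod_(d <- divisors n) P d = 'X^n - 1.
  move=> n_gt0; rewrite -rmorph_prod prod_Cyclotomic //.
  by rewrite rmorphB /= rmorph1 map_polyXn.
have rootP s y : root (\prod_(d <- s) P d) y = has (fun d => root (P d) y) s.
  elim: s => [|d s IHs]; first by rewrite big_nil (negbTE (root1 y)).
  by rewrite big_cons rootM IHs.
have unitP n d y : (0 < n)%N -> (d %| n)%N -> root (P d) y -> y ^+ n = 1.
  move=> n_gt0 dn /eqP y0; apply/eqP; rewrite -subr_eq0.
  have <- : ('X^n - 1).[y] = y ^+ n - 1 by rewrite !hornerE.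
  rewrite -(prodP n) // (big_rem d) ?hornerM ?y0 ?mul0r //=.
  by rewrite -dvdn_divisors.
apply/idP/idP => [z0 | primz].
  have /(prim_order_exists m_gt0)[d primd dm] := unitP m m z m_gt0 (dvdnn m) z0.
  have d_gt0 := prim_order_gt0 primd.
  case: (eqVneq d m) => [<- // | ne_dm].
  have [e ed /= ez] : exists2 e, e \in divisors d & root (P e) z.
    have : root ('X^d - 1) z.
      by rewrite /root !hornerE (prim_expr_order primd) subrr.
    by rewrite -(prodP d) // rootP => /hasP.
  have em : (e %| m)%N.
    by apply: dvdn_trans dm; rewrite dvdn_divisors.
  have ne_em : e != m.
    apply: contraNneq ne_dm => em'; rewrite eqn_dvd dm /= -em'.
    by rewrite dvdn_divisors.
  have sep := separable_Xn_sub_1 nzm.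
  suff : ~~ separable_poly ('X^m - 1 : {poly L}) by rewrite sep.
  have memP : m \in divisors m by rewrite -dvdn_divisors.
  rewrite -(prodP m) // (big_rem m) //= (big_rem e) /=; last first.
    by rewrite mem_rem_uniq ?divisors_uniq // inE ne_em -dvdn_divisors.
  rewrite mulrA separable_mul !negb_and separable_mul !negb_and.
  suff -> : ~~ coprimep (P m) (P e) by rewrite !orbT.
  by apply/negP => /coprimep_root /(_ z0); rewrite (eqP ez) eqxx.
have /hasP[d dm dz] : has (fun d => root (P d) z) (divisors m).
  by rewrite -rootP prodP // /root !hornerE
    (prim_expr_order primz) subrr.
rewrite -dvdn_divisors // in dm.
have d_gt0 := dvdn_gt0 m_gt0 dm.
suff <- : d = m by [].
apply/eqP; rewrite eqn_dvd dm /=.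
by rewrite (prim_order_dvd primz) (unitP d d).
Qed.

Definition lambda (k : fieldType) (q : k) (c : nat -> k) (a : nat) : k :=
  c a / (q + q^-1 + 2).

Section Couples.
Variables (k : fieldType) (m : nat) (q : k) (c : nat -> k).

Definition ldiagonalizable (V : vectType k) (f : 'End(V)) : Prop :=
  exists b : seq V, basis_of fullv b /\
    {in b, forall v, exists a : k, f v = a *: v}.

Definition couple_eigenvalue (x : k) : Prop :=
  [\/ x = 1,
      exists2 a : nat, (1 <= a <= (m - 1)./2)%N & x = lambda q c a
    | ~~ odd m /\ x = 0].

Definition couple (V W : vectType k) (f : 'Hom(V, W)) (g : 'Hom(W, V)) :
    Prop :=
  [/\ ldiagonalizable (g \o f)%VF /\ ldiagonalizable (f \o g)%VF,
      forall x, passmx.leigenvalue (g \o f)%VF x -> couple_eigenvalue x,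
      forall x, passmx.leigenvalue (f \o g)%VF x -> couple_eigenvalue x
    & ~~ odd m ->
      (forall v, (g \o f)%VF v = 0 -> f v = 0) /\
      (forall w, (f \o g)%VF w = 0 -> g w = 0)].

End Couples.

Section HRepresentation.
Variables (k : fieldType) (I : finType) (M : I -> I -> nat) (q : k).
Variables (c : nat -> nat -> k) (V : I -> vectType k).
(* Only the maps A i j with i != j are part of the data. *)
Variable A : forall i j, 'Hom(V i, V j).

Definition Vij (i j : I) : {vspace V i} := lker ((A j i \o A i j) - \1)%VF.

Definition H_representation : Prop :=
  [/\ forall i j, i != j -> couple (M i j) q (c (M i j)) (A i j) (A j i),
      forall i j l, i != j -> j != l -> i != l ->
        forall x, x \in Vij i j -> A i l x = A j l (A i j x)
    & forall i j l, i != j -> j != l -> i != l ->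
        (limg (A l j - (A i j \o A l i))%VF
           <= limg (\1 - (A i j \o A j i))%VF)%VS].

End HRepresentation.

(* 'End(V) has no canonical ring structure in MathComp, since V may be 0. *)
Record representation (k : fieldType) (A : algType k) (V : vectType k) :=
  Representation {
    rep_lin :> {linear A -> 'End(V)};
    rep1 : rep_lin 1 = \1%VF;
    repM : forall x y, rep_lin (x * y) = (rep_lin x \o rep_lin y)%VF
  }.

Section QuiverData.
Variables (k : fieldType) (I : finType) (q : k) (M : I -> I -> nat).
Variables (V : vectType k) (rho : representation (hecke q M) V).

Definition eigq (i : I) : {vspace V} :=
  passmx.leigenspace (rho (sigma q M i)) q.

Definition eigN1 (i : I) : {vspace V} :=
  passmx.leigenspace (rho (sigma q M i)) (-1).

(* daddv_pi U W is the projection onto U along W; V is the direct sum of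
   eigq j and eigN1 j because q != -1, which genericity implies as soon as
   there are two distinct indices. *)
Definition quiver_map (i j : I) :
    'Hom(subvs_of (eigq i), subvs_of (eigq j)) :=
  (linfun (vsproj (eigq j)) \o daddv_pi (eigq j) (eigN1 j)
     \o linfun (@vsval k V (eigq i)))%VF.

End QuiverData.

(* Main.v *)
From HB Require Import structures.
Require Import Defs.
From mathcomp Require Import all_boot all_order all_algebra all_field.
From mathcomp Require Import boolp monalg ring zify.

Set Implicit Arguments.
Unset Strict Implicit.
Unset Printing Implicit Defensive.

Import GRing.Theory.
Local Open Scope ring_scope.

(** A semisimple ring is von Neumann regular: every [w] is [w y w] for some [y].
    In the dihedral Hecke algebra, with [e], [f] the projections [(s + 1)/(q + 1)]
    and [(t + 1)/(q + 1)], apply this to an element [w] that generates a line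
    modulo some ideal: whenever [w w] lies in the ideal, so does [w].  This gives
    [f e] in [A e f e], [(1 - f) e] in [A (e - e f e)], [f (1 - e)] in
    [(f - f e f) A] and [h] in [A h^2] for [h = e f e - l e], that is, the condition
    on the eigenvalue 0, the conditions (b) and (c), the decomposition of [V], and
    the absence of Jordan blocks in [e f e].

    For the eigenvalues, the braid relation says that the Kazhdan-Lusztig element
    [K] of the longest word can be written with either first letter, so
    [e K = f K = K] and [(e f e - 1) K e = 0].  The recursion for these elements
    makes [K e] a Chebyshev polynomial in [e f e], whose roots are the
    [lambda q c a]: this factorisation holds in characteristic 0, and it is carried
    to any field along [Z[X]/Phi_m]. *)

(** * The universal property of the Hecke algebra *)

Section Lift.
Variables (k : fieldType) (I : choiceType) (A : algType k) (g : I -> A).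

Let word (w : {fmonom I}) : A := \prod_(i <- (w : seq I)) g i.

Fact word_mmorphism : mmorphism word.
Proof. by split=> [x y|]; rewrite /word ?fmM ?big_cat // fm1 big_nil. Qed.

HB.instance Definition _ := isMultiplicative.Build _ A word word_mmorphism.

Definition free_lift : free_algebra k I -> A := mmap (in_alg A) word.

Lemma free_liftD : {morph free_lift : x y / x + y}.
Proof. exact: mmapD. Qed.

Lemma free_liftB : {morph free_lift : x y / x - y}.
Proof. exact: mmapB. Qed.

Lemma free_lift0 : free_lift 0 = 0.
Proof. exact: mmap0. Qed.

Lemma free_lift1 : free_lift 1 = 1.
Proof. exact: mmap1. Qed.

(** [mmap] is multiplicative when the images of coefficients commute with those of words; here the
    former are scalars, hence central. *)
Lemma free_liftM : {morph free_lift : x y / x * y}.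
Proof.
have := @commr_mmap_is_multiplicative _ _ _ (in_alg A) word.
by case=> // x m w; rewrite /GRing.comm /= mulr_algl mulr_algr.
Qed.

Lemma free_liftZ a : {morph free_lift : x / a *: x}.
Proof. by move=> x; rewrite /free_lift mmapZ /= mulr_algl. Qed.

Lemma free_lift_gen i : free_lift (free_gen k i) = g i.
Proof. by rewrite /free_lift mmapU /= scale1r mul1r /word fmU big_seq1. Qed.

Lemma free_lift_alternating n i j :
  free_lift (alternating n (free_gen k i) (free_gen k j)) =
  alternating n (g i) (g j).
Proof.
elim: n i j => [|n IHn] i j /=; first exact: free_lift1.
by rewrite free_liftM IHn free_lift_gen.
Qed.

Lemma free_lift_ind (P : A -> Prop) :
    P 1 -> (forall x y, P x -> P y -> P (x + y)) ->
    (forall a x, P x -> P (a *: x)) -> (forall x y, P x -> P y -> P (x * y)) ->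
    (forall i, P (g i)) -> forall x, P (free_lift x).
Proof.
move=> P1 PD PZ PM Pg x; rewrite /free_lift mmapE.
apply: (big_ind P) => // [|w _]; first by rewrite -(scale0r 1); apply: PZ.
rewrite /= mulr_algl; apply: PZ.
by rewrite /word; apply: (big_ind P).
Qed.

End Lift.

(** Write [1 = y x + z] with [z] in a complement [L'] of [A x]: then [x z = (1 - x y) x] lies in
    both [A x] and [L'], hence is 0. *)
Lemma semisimple_ring_regular (A : nzRingType) :
  semisimple_ring A -> forall x : A, exists y, x = x * y * x.
Proof.
move=> ssA x; pose L (z : A) := exists y, z = y * x.
have idL : left_ideal L.
  split=> [|_ _ [y ->] [z ->]|a _ [y ->]]; first by exists 0; rewrite mul0r.
    by exists (y + z); rewrite mulrDl.
  by exists (a * y); rewrite mulrA.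
have [L' [[_ _ L'M] LL' LDL']] := ssA L idL.
have [_ [z [[y ->] L'z one]]] := LDL' 1.
exists y; have xE : x = x * y * x + x * z.
  by rewrite -mulrA -mulrDr -one mulr1.
rewrite {1}xE (LL' (x * z)) ?addr0 //; last exact: L'M.
by exists (1 - x * y); apply/eqP; rewrite mulrBl mul1r eq_sym subr_eq addrC -xE.
Qed.

Section DihedralLift.
Variables (k : fieldType) (A : algType k) (q : k) (m : nat) (g : bool -> A).
Hypothesis quad : forall b, (g b - q%:A) * (g b + 1) = 0.
Hypothesis braid :
  alternating m (g true) (g false) = alternating m (g false) (g true).

Lemma free_lift_hecke_ideal x :
  ideal_gen (hecke_relator q (dihedral m)) x -> free_lift g x = 0.
Proof.
move/(_ (fun x => free_lift g x = 0)); apply=> [|_ [b b' neq|b]].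
- split; last by move=> a y y0; rewrite free_liftM y0 mul0r.
  split=> [|y z y0 z0|a y y0]; first exact: free_lift0.
    by rewrite free_liftD y0 z0 addr0.
  by rewrite free_liftM y0 mulr0.
- rewrite free_liftB !free_lift_alternating /dihedral (negbTE neq).
  by case: b b' neq => [] [] // _; rewrite braid subrr.
- by rewrite free_liftM free_liftB free_liftD free_liftZ free_lift1
    free_lift_gen quad.
Qed.

(** Regularity passes to images: [x = x y x] holds up to the ideal, which the lift kills. *)
Lemma free_lift_regular :
  semisimple_ring (hecke q (dihedral m)) ->
  forall x, exists y,
    free_lift g x = free_lift g x * free_lift g y * free_lift g x.
Proof.
move=> /semisimple_ring_regular reg x.
have [y] := reg (hecke_pi q (dihedral m) x); rewrite -[y]hecke_reprK.
rewrite -![_ * _]/(hecke_mul _ _) !hecke_piM => /hecke_eqP.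
move=> /asboolP /free_lift_hecke_ideal /eqP.
rewrite free_liftB subr_eq0 !free_liftM => /eqP.
by exists (repr y).
Qed.

End DihedralLift.

(* For [q = -1], both generators act on [k[X]/X^2] by [X - 1], and there
   [sigma + 1] becomes a nonzero nilpotent of a commutative ring. *)
Lemma semisimple_dihedral_neqN1 (k : fieldType) (q : k) (m : nat) :
  semisimple_ring (hecke q (dihedral m)) -> q != -1.
Proof.
move=> ss; apply/eqP => qN1.
pose J (x : free_algebra k bool) :=
  'X^2 %| free_lift (fun=> 'X - 1 : {poly k}) x.
have [y] := semisimple_ring_regular ss (hecke_pi _ _ (free_gen k true + 1)).
rewrite -[y]hecke_reprK -![_ * _]/(hecke_mul _ _) !hecke_piM.
move=> /hecke_eqP /asboolP /(_ J) Jx.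
suff : J (free_gen k true + 1 - (free_gen k true + 1) * repr y
           * (free_gen k true + 1)).
  rewrite /J free_liftB !free_liftM !free_liftD free_lift_gen free_lift1.
  rewrite subrK mulrAC -expr2 dvdp_subl ?dvdp_mulIl //.
  by move/dvdp_leq; rewrite polyX_eq0 size_polyXn size_polyX => /(_ isT).
apply: Jx => [|_ [b b' neq|b]].
- split; last by move=> a z z0; rewrite /J free_liftM dvdp_mulr.
  split=> [|z t z0 t0|a z z0]; first by rewrite /J free_lift0 dvdp0.
    by rewrite /J free_liftD dvdp_add.
  by rewrite /J free_liftM dvdp_mull.
- by rewrite /J free_liftB !free_lift_alternating subrr dvdp0.
- rewrite /J free_liftM free_liftB free_liftD free_liftZ free_lift1.
  by rewrite free_lift_gen qN1 scaleN1r opprK subrK -expr2 dvdpp.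
Qed.

(** * Two idempotents in a regular algebra *)

Section TwoIdempotents.
Variables (k : fieldType) (A : algType k).

Definition in_alg2 (e f x : A) : Prop :=
  forall T : A -> Prop, T 1 -> (forall y z, T y -> T z -> T (y + z)) ->
    (forall a y, T y -> T (a *: y)) -> (forall y z, T y -> T z -> T (y * z)) ->
    T e -> T f -> T x.

(** The element [y] is asked to lie in the same subalgebra, so that it preserves every submodule
    stable under [e] and [f]. *)
Definition regular_pair (e f : A) : Prop :=
  forall x, in_alg2 e f x -> exists2 y, in_alg2 e f y & x = x * y * x.

Lemma in_alg2C e f x : in_alg2 e f x -> in_alg2 f e x.
Proof. by move=> x_ef T T1 TD TZ TM Tf Te; apply: x_ef. Qed.

Lemma regular_pairC e f : regular_pair e f -> regular_pair f e.
Proof. by move=> reg x /in_alg2C/reg[y /in_alg2C fey xE]; exists y. Qed.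

Variables e f : A.

Lemma in_alg2D x y : in_alg2 e f x -> in_alg2 e f y -> in_alg2 e f (x + y).
Proof.
by move=> hx hy T T1 TD TZ TM Te Tf; apply: (TD); [exact: hx | exact: hy].
Qed.
Lemma in_alg2Z a x : in_alg2 e f x -> in_alg2 e f (a *: x).
Proof. by move=> hx T T1 TD TZ TM Te Tf; apply: (TZ); exact: hx. Qed.
Lemma in_alg2M x y : in_alg2 e f x -> in_alg2 e f y -> in_alg2 e f (x * y).
Proof.
by move=> hx hy T T1 TD TZ TM Te Tf; apply: (TM); [exact: hx | exact: hy].
Qed.
Lemma in_alg2B x y : in_alg2 e f x -> in_alg2 e f y -> in_alg2 e f (x - y).
Proof. by move=> hx hy; rewrite -scaleN1r; apply: in_alg2D => //; apply: in_alg2Z. Qed.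

Hypotheses (ee : e * e = e) (ff : f * f = f) (reg : regular_pair e f).

(* As [w = w y w], it is enough to know that [w] maps the submodule [S]
   generated by [w] into [J]. *)
Lemma regular_left (S J : A -> Prop) w :
    in_alg2 e f w -> S w -> (forall x y, S x -> S y -> S (x + y)) ->
    (forall a x, S x -> S (a *: x)) -> (forall x, S x -> S (e * x)) ->
    (forall x, S x -> S (f * x)) -> (forall x, S x -> J (w * x)) -> J w.
Proof.
move=> /reg[y efy wE] Sw SD SZ Se Sf SJ; rewrite wE -mulrA; apply: SJ.
suff: forall x, S x -> S (y * x) by apply.
apply: (efy (fun y => forall x, S x -> S (y * x))) => //.
- by move=> x Sx; rewrite mul1r.
- by move=> u v Su Sv x Sx; rewrite mulrDl; apply: SD; auto.
- by move=> a u Su x Sx; rewrite -scalerAl; apply: SZ; auto.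
- by move=> u v Su Sv x Sx; rewrite -mulrA; auto.
Qed.

Lemma regular_right (S J : A -> Prop) w :
    in_alg2 e f w -> S w -> (forall x y, S x -> S y -> S (x + y)) ->
    (forall a x, S x -> S (a *: x)) -> (forall x, S x -> S (x * e)) ->
    (forall x, S x -> S (x * f)) -> (forall x, S x -> J (x * w)) -> J w.
Proof.
move=> /reg[y efy wE] Sw SD SZ Se Sf SJ; rewrite wE; apply: SJ.
suff: forall x, S x -> S (x * y) by apply.
apply: (efy (fun y => forall x, S x -> S (x * y))) => //.
- by move=> x Sx; rewrite mulr1.
- by move=> u v Su Sv x Sx; rewrite mulrDr; apply: SD; auto.
- by move=> a u Su x Sx; rewrite -scalerAr; apply: SZ; auto.
- by move=> u v Su Sv x Sx; rewrite mulrA; auto.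
Qed.

(** [k w + A h] is stable under [e] and [f], and [w] maps it into [A h]. *)
Lemma regular_line_left w h :
    in_alg2 e f w -> (exists a z, e * w = a *: w + z * h) ->
    (exists a z, f * w = a *: w + z * h) -> (exists z, w * w = z * h) ->
  exists z, w = z * h.
Proof.
move=> efw [a [z ew]] [b [t fw]] [s ww].
pose S x := exists c u, x = c *: w + u * h.
apply: (@regular_left S (fun x => exists z, x = z * h)) => //.
- by exists 1, 0; rewrite mul0r addr0 scale1r.
- move=> _ _ [c [u ->]] [d [v ->]]; exists (c + d), (u + v).
  by rewrite scalerDl mulrDl addrACA.
- by move=> c _ [d [v ->]]; exists (c * d), (c *: v); rewrite scalerDr scalerA scalerAl.
- move=> _ [c [u ->]]; exists (c * a), (c *: z + e * u).
  by rewrite mulrDr -scalerAr ew scalerDr scalerA mulrDl -scalerAl mulrA addrA.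
- move=> _ [c [u ->]]; exists (c * b), (c *: t + f * u).
  by rewrite mulrDr -scalerAr fw scalerDr scalerA mulrDl -scalerAl mulrA addrA.
- move=> _ [c [u ->]]; exists (c *: s + w * u).
  by rewrite mulrDr -scalerAr ww mulrDl -scalerAl mulrA.
Qed.

Lemma regular_line_right w h :
    in_alg2 e f w -> (exists a z, w * e = a *: w + h * z) ->
    (exists a z, w * f = a *: w + h * z) -> (exists z, w * w = h * z) ->
  exists z, w = h * z.
Proof.
move=> efw [a [z ew]] [b [t fw]] [s ww].
pose S x := exists c u, x = c *: w + h * u.
apply: (@regular_right S (fun x => exists z, x = h * z)) => //.
- by exists 1, 0; rewrite mulr0 addr0 scale1r.
- move=> _ _ [c [u ->]] [d [v ->]]; exists (c + d), (u + v).
  by rewrite scalerDl mulrDr addrACA.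
- by move=> c _ [d [v ->]]; exists (c * d), (c *: v); rewrite scalerDr scalerA scalerAr.
- move=> _ [c [u ->]]; exists (c * a), (c *: z + u * e).
  by rewrite mulrDl -scalerAl ew scalerDr scalerA mulrDr -scalerAr mulrA addrA.
- move=> _ [c [u ->]]; exists (c * b), (c *: t + u * f).
  by rewrite mulrDl -scalerAl fw scalerDr scalerA mulrDr -scalerAr mulrA addrA.
- move=> _ [c [u ->]]; exists (c *: s + u * w).
  by rewrite mulrDl -scalerAl ww mulrDr -scalerAr mulrA.
Qed.

(** With [w = f e] and [h = e f e]: [e w = h], [f w = w], [w w = f h]. *)
Lemma regular_mul_factor : exists z, f * e = z * (e * f * e).
Proof.
apply: regular_line_left; first exact: in_alg2M.
- by exists 0, 1; rewrite scale0r add0r mul1r mulrA.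
- by exists 1, 0; rewrite scale1r mul0r addr0 mulrA ff.
- by exists f; rewrite !mulrA.
Qed.

(** With [w = (1 - f) e] and [h = e - e f e]: [e w = h], [f w = 0], [w w = (1 - f) h]. *)
Lemma regular_compl_factor : exists z, (1 - f) * e = z * (e - e * f * e).
Proof.
have ff0 : f * (1 - f) = 0 by rewrite mulrBr mulr1 ff subrr.
apply: regular_line_left.
- by apply: in_alg2M => //; apply: in_alg2B.
- exists 0, 1.
  by rewrite scale0r add0r mul1r mulrA mulrBr mulr1 mulrBl ee.
- by exists 0, 0; rewrite scale0r add0r mul0r mulrA ff0 mul0r.
- exists (1 - f); rewrite -[LHS]mulrA; congr (_ * _).
  by rewrite mulrA mulrBr mulr1 mulrBl ee.
Qed.

(** With [w = f (1 - e)] and [h = f - f e f]: [w e = 0], [w f = h], [w w = h (1 - e)]. *)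
Lemma regular_factor_compl : exists z, f * (1 - e) = (f - f * e * f) * z.
Proof.
have ee0 : (1 - e) * e = 0 by rewrite mulrBl mul1r ee subrr.
apply: regular_line_right.
- by apply: in_alg2M => //; apply: in_alg2B.
- by exists 0, 0; rewrite scale0r add0r mulr0 -mulrA ee0 mulr0.
- exists 0, 1.
  by rewrite scale0r add0r mulr1 mulrBr mulr1 mulrBl ff.
- exists (1 - e); rewrite [LHS]mulrA; congr (_ * _).
  by rewrite mulrBr mulr1 mulrBl ff.
Qed.

(** A plane replaces the line: modulo [A h^2] the submodule generated by [h] is spanned by [h] and
    [f h], because [e h = h] and [e f h = h^2 + a h]. Left multiplication by [h] sends both into
    [A h^2], as [h f h = (h + a) h^2]. *)
Lemma regular_square_factor a (h := e * f * e - a *: e) :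
  exists z, h = z * (h * h).
Proof.
have hE : h = e * f * e - a *: e by []; clearbody h.
have eh : e * h = h by rewrite hE mulrBr -scalerAr ee !mulrA ee.
have efeE : e * f * e = h + a *: e by rewrite hE subrK.
have efh : e * (f * h) = h * h + a *: h.
  by rewrite -{1}eh !mulrA efeE mulrDl -scalerAl eh.
have hfh : h * (f * h) = (h + a *: 1) * (h * h).
  rewrite {1}hE mulrBl -scalerAl efh -!mulrA efh 2!mulrDr -!scalerAr efh addrK.
  by rewrite [f * _]mulrA [e * _]mulrA efh !mulrDl -!scalerAl mul1r mulrA.
pose S x := exists b c z, x = b *: h + c *: (f * h) + z * (h * h).
apply: (@regular_left S (fun x => exists z, x = z * (h * h))) => //.
- rewrite hE; apply: in_alg2B; last exact: in_alg2Z.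
  by apply: in_alg2M => //; apply: in_alg2M.
- by exists 1, 0, 0; rewrite mul0r scale0r !addr0 scale1r.
- move=> _ _ [b [c [z ->]]] [b' [c' [z' ->]]].
  exists (b + b'), (c + c'), (z + z').
  by rewrite !scalerDl mulrDl [LHS]addrACA (addrACA (b *: h)).
- move=> d _ [b [c [z ->]]]; exists (d * b), (d * c), (d *: z).
  by rewrite !scalerDr !scalerA (scalerAl d z).
- move=> _ [b [c [z ->]]]; exists (b + c * a), 0, (c *: 1 + e * z).
  rewrite 2!mulrDr -!scalerAr eh efh scale0r addr0 scalerDr scalerA scalerDl.
  by rewrite mulrDl -scalerAl mul1r mulrA -!addrA; congr (_ + _); rewrite addrCA.
- move=> _ [b [c [z ->]]]; exists 0, (b + c), (f * z).
  by rewrite 2!mulrDr -!scalerAr [f * (f * h)]mulrA ff mulrA scale0r add0r scalerDl.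
- move=> _ [b [c [z ->]]]; exists (b *: 1 + c *: (h + a *: 1) + h * z).
  by rewrite 2!mulrDr -!scalerAr hfh [h * (z * _)]mulrA [RHS]mulrDl
    [in RHS]mulrDl -!scalerAl mul1r.
Qed.
End TwoIdempotents.

(** * The braid relation *)

(* With [t = 4 x^2] this is [(U_{2r} x, U_{2r-1} x / (2 x))], for [U] the Chebyshev
   polynomials of the second kind. *)
Fixpoint cheb (R : pzRingType) (t : R) (r : nat) : R * R :=
  if r is r'.+1 then
    let: (a, b) := cheb t r' in (t * (a - b) - a, a - b)
  else (1, 0).

Lemma chebS (R : pzRingType) (t : R) r :
  cheb t r.+1 = (t * ((cheb t r).1 - (cheb t r).2) - (cheb t r).1,
                 (cheb t r).1 - (cheb t r).2).
Proof. by rewrite /=; case: (cheb t r). Qed.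

Lemma rmorph_cheb (R S : pzRingType) (h : {rmorphism R -> S}) t r :
  cheb (h t) r = (h (cheb t r).1, h (cheb t r).2).
Proof.
elim: r => [|r IHr]; first by rewrite /= rmorph1 rmorph0.
by rewrite !chebS IHr /= !rmorphB rmorphM rmorphB.
Qed.

Lemma comm_cheb (R : pzRingType) (t x : R) r : GRing.comm x t ->
  GRing.comm x (cheb t r).1 /\ GRing.comm x (cheb t r).2.
Proof.
move=> xt; elim: r => [|r [IH1 IH2]]; first by split; [apply: commr1 | apply: commr0].
rewrite chebS /=; split; last exact: commrB.
by apply: commrB => //; apply: commrM => //; apply: commrB.
Qed.

Section Braid.
Variables (k : fieldType) (A : algType k) (q : k).

(* [\sum_(w <= alternating n s t) w] in the Bruhat order of the dihedral
   group: a Kazhdan-Lusztig basis element. *)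
Definition kl_sum (s t : A) (n : nat) : A :=
  alternating n s t + (\sum_(l < n) (alternating l s t + alternating l t s) - 1).

(** The [- 1] corrects for the empty word, counted twice when [n > 0]. The value 0 at [n = 0] is the
    one that the recursion [kl_sumSS] requires. *)
Lemma kl_sum0 s t : kl_sum s t 0 = 0.
Proof. by rewrite /kl_sum big_ord0 sub0r subrr. Qed.

Lemma kl_sum1 s t : kl_sum s t 1 = s + 1.
Proof. by rewrite /kl_sum big_ord1 /= mulr1 addrK. Qed.

Lemma kl_sumC s t m : alternating m s t = alternating m t s ->
  kl_sum s t m = kl_sum t s m.
Proof.
move=> braid; rewrite /kl_sum braid; congr (_ + (_ - _)).
by apply: eq_bigr => l _; rewrite addrC.
Qed.

(** The product rule for Kazhdan-Lusztig elements. As [(s + 1) s = q (s + 1)], left multiplication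
    by [s + 1] sends a word [s w] to [q (s w + w)], and a word [w] starting with [t] to
    [s w + w]. *)
Lemma kl_sumSS s t n : (s - q%:A) * (s + 1) = 0 ->
  kl_sum s t n.+2 = (s + 1) * kl_sum t s n.+1 - q *: kl_sum s t n.
Proof.
move=> quad; pose a l := alternating l s t; pose b l := alternating l t s.
pose S l : A := \sum_(i < l) (a i + b i) - 1.
have us : (s + 1) * s = q *: (s + 1).
  rewrite mulrDl mul1r -[X in _ + X]mulr1 -mulrDr.
  by apply/eqP; rewrite -subr_eq0 -mulr_algl -mulrBl quad.
have ua l : (s + 1) * a l.+1 = q *: (a l.+1 + b l).
  by rewrite /a /= mulrA us -scalerAl mulrDl mul1r.
have ub l : (s + 1) * b l = a l.+1 + b l by rewrite mulrDl mul1r.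
have SS l : S l.+1 = S l + (a l + b l) by rewrite /S big_ord_recr /= addrAC.
have S0 : S 0 = - 1 by rewrite /S big_ord0 sub0r.
have klst l : kl_sum s t l = a l + S l by [].
have klts l : kl_sum t s l = b l + S l.
  by rewrite /kl_sum; congr (_ + (_ - _)); apply: eq_bigr => i _; rewrite addrC.
have a0 : a 0 = 1 by []. have b0 : b 0 = 1 by []. have a1 : a 1 = s by apply: mulr1.
clearbody a b S.
(* The right side is [kl_sum s t l.+1 + q *: kl_sum s t l]. *)
have uS l : (s + 1) * S l.+1 = S l.+1 + a l.+1 + q *: (a l + S l).
  elim: l => [|l IHl].
    by rewrite SS S0 a0 b0 a1 addKr subrr scaler0 addr0 mulr1 addrC.
  rewrite [S l.+2]SS mulrDr IHl mulrDr ua ub.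
  have <- : q *: (a l + S l) + q *: (a l.+1 + b l) = q *: (a l.+1 + S l.+1).
    by rewrite -scalerDr SS !addrA [in LHS](ACl (3*2*1*4)).
  by rewrite !addrA [in LHS](ACl (1*2*6*5*3*4)).
rewrite klts !klst mulrDr ub uS !addrA addrK [S n.+2]SS.
by rewrite !addrA [in LHS](ACl (1*4*2*3)).
Qed.

Lemma kl_sum_mull s t n :
    (s - q%:A) * (s + 1) = 0 -> (t - q%:A) * (t + 1) = 0 ->
  (s + 1) * kl_sum s t n = (q + 1) *: kl_sum s t n.
Proof.
have uu x : (x - q%:A) * (x + 1) = 0 -> (x + 1) * (x + 1) = (q + 1) *: (x + 1).
  move=> quad; apply/eqP; rewrite -subr_eq0 -mulr_algl -mulrBl scalerDl.
  by rewrite scale1r opprD addrACA subrr addr0 quad.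
move=> quads quadt; elim/ltn_ind: n s t quads quadt => -[|[|n]] IHn s t quads quadt.
- by rewrite kl_sum0 mulr0 scaler0.
- by rewrite kl_sum1 uu.
- by rewrite kl_sumSS // mulrBr mulrA uu // -scalerAl -scalerAr IHn // scalerBr
    [in RHS]scalerA [in LHS]scalerA mulrC.
Qed.
End Braid.

(** * A polynomial in [e f e] that annihilates [e] *)

Section Annihilator.
Variables (k : fieldType) (A : algType k) (q : k) (e f : A).
Hypotheses (q0 : q != 0) (qN1 : q + 1 != 0) (ee : e * e = e) (ff : f * f = f).

Let s := (q + 1) *: e - 1.
Let t := (q + 1) *: f - 1.
Let x := e * f * e.
(** The factor is [q + q^-1 + 2]: it turns an eigenvalue [lambda q c a] of [x] into [c a]. *)
Let xi := ((q + 1) ^+ 2 / q) *: x.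

Lemma idem_quadratic (p : A) : p * p = p ->
  ((q + 1) *: p - 1 - q%:A) * ((q + 1) *: p - 1 + 1) = 0.
Proof.
move=> pp; rewrite subrK -addrA -opprD -[X in X + q%:A]scale1r -scalerDl [1 + q]addrC.
by rewrite mulrBl -!scalerAl -!scalerAr pp mul1r subrr.
Qed.

(** Two steps of [kl_sumSS] amount to one step of [cheb]. The factor [q] on the left of the second
    identity keeps the exponent of [q] nonnegative at [r = 0]. *)
Lemma kl_sum_cheb r :
  (kl_sum s t r.*2.+1 * e = ((q + 1) * q ^+ r) *: ((cheb xi r).1 * e)) /\
  (q *: (kl_sum t s r.*2 * e) =
    ((q + 1) ^+ 2 * q ^+ r) *: (f * ((cheb xi r).2 * e))).
Proof.
have u : s + 1 = (q + 1) *: e by rewrite subrK.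
have v : t + 1 = (q + 1) *: f by rewrite subrK.
have quads : (s - q%:A) * (s + 1) = 0 by exact: idem_quadratic.
have quadt : (t - q%:A) * (t + 1) = 0 by exact: idem_quadratic.
clearbody s t.
have exi : GRing.comm e xi.
  by rewrite /GRing.comm /xi -scalerAl -scalerAr /x !mulrA ee -!mulrA ee.
elim: r => [|r [IH1 IH2]].
  rewrite kl_sum1 kl_sum0 u -scalerAl ee expr0 !mulr1 mul1r.
  by rewrite !(mul0r, mulr0, scaler0).
rewrite doubleS chebS; set a := (cheb xi r).1; set b := (cheb xi r).2.
have IH2' : kl_sum t s r.*2.+2 * e = ((q + 1) ^+ 2 * q ^+ r) *: (f * ((a - b) * e)).
  rewrite (@kl_sumSS _ _ q) // v [LHS]mulrBl -!scalerAl -[f * _ * e]mulrA IH1.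
  by rewrite IH2 -scalerAr scalerA mulrA -expr2 [in RHS]mulrBl [in RHS]mulrBr scalerBr.
have ab : GRing.comm e (a - b).
  by case: (comm_cheb r exi) => ea eb; apply: commrB.
split; last by rewrite IH2' scalerA mulrCA -exprS.
rewrite (@kl_sumSS _ _ q) // u [LHS]mulrBl -!scalerAl -[e * _ * e]mulrA IH2' IH1.
rewrite -scalerAr !scalerA [in RHS]mulrBl scalerBr; congr (_ - _); last first.
  by rewrite mulrCA -exprS.
have -> : e * (f * ((a - b) * e)) = x * ((a - b) * e).
  rewrite -{1}ab -[in RHS]ab /x -!mulrA; congr (_ * (_ * _)).
  by rewrite mulrA ee.
rewrite /xi -!scalerAl scalerA -mulrA; congr (_ *: _).
by rewrite (exprS q r); field.
Qed.
Lemma kl_sum_fix (p c : A) m :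
    p * p = p -> c * c = c ->
  p * kl_sum ((q + 1) *: p - 1) ((q + 1) *: c - 1) m =
    kl_sum ((q + 1) *: p - 1) ((q + 1) *: c - 1) m.
Proof.
move=> pp cc; have := kl_sum_mull m (idem_quadratic pp) (idem_quadratic cc).
by rewrite [_ - 1 + 1]subrK -scalerAl => /(scalerI qN1).
Qed.

(** For [m] even, [kl_sum_cheb] describes [kl_sum t s m]; multiplying it by [e], which fixes it,
    produces the additional factor [x], the source of the eigenvalue 0. *)
Lemma braid_annihilator r m : alternating m s t = alternating m t s ->
  (m = r.*2.+1 -> (x - 1) * ((cheb xi r).1 * e) = 0) /\
  (m = r.*2 -> (x - 1) * (x * ((cheb xi r).2 * e)) = 0).
Proof.
move=> braid; have [odd_r even_r] := kl_sum_cheb r.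
have exi : GRing.comm e xi.
  by rewrite /GRing.comm /xi -scalerAl -scalerAr /x !mulrA ee -!mulrA ee.
have eK : e * kl_sum s t m = kl_sum s t m by apply: kl_sum_fix.
have fK : f * kl_sum s t m = kl_sum s t m.
  by rewrite (kl_sumC braid); apply: kl_sum_fix.
have xK : (x - 1) * (kl_sum s t m * e) = 0.
  by rewrite mulrBl mul1r mulrA /x -!mulrA [e * (kl_sum _ _ _ * e)]mulrA eK
    [f * _]mulrA fK [e * _]mulrA eK subrr.
split=> mE; move: xK.
  have qr0 : (q + 1) * q ^+ r != 0 by rewrite mulf_neq0 // expf_neq0.
  by rewrite mE odd_r -scalerAr -[RHS](scaler0 _ ((q + 1) * q ^+ r)) => /(scalerI qr0).
have qr0 : (q + 1) ^+ 2 * q ^+ r != 0 by rewrite mulf_neq0 // expf_neq0.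
have xE : x * ((cheb xi r).2 * e) = e * (f * ((cheb xi r).2 * e)).
  case: (comm_cheb r exi) => _ <-; rewrite /x -!mulrA; congr (_ * (_ * _)).
  by rewrite mulrA ee.
rewrite -eK -mulrA (kl_sumC braid) xE mE => xK; apply: (scalerI qr0).
by rewrite scaler0 scalerAr (scalerAr _ e) -even_r -!scalerAr xK scaler0.
Qed.

End Annihilator.

(** * Factorisation of the Chebyshev polynomials *)

Definition int_eval (R : comNzRingType) (z : R) : {rmorphism {poly int} -> R} :=
  horner_eval z \o map_poly intr.

(* [z] need not be a primitive root of unity (the characteristic may divide [m]),
   but the kernel of evaluation at [zeta] is generated by the monic ['Phi_m]. *)
Lemma int_eval_cyclotomic (L : fieldType) (m : nat) (zeta : algC) (z : L) p :
    m.-primitive_root zeta -> root (map_poly intr (Cyclotomic m)) z ->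
  int_eval zeta p = 0 -> int_eval z p = 0.
Proof.
move=> prim zm; pose P := Cyclotomic m; have monP : P \is monic := Cyclotomic_monic m.
have evP : int_eval zeta P = 0.
  rewrite /int_eval /= /horner_eval (Cintr_Cyclotomic prim); apply/eqP.
  by rewrite -/(root _ _) root_cyclotomic.
have evPz : int_eval z P = 0 by apply/eqP.
rewrite (Pdiv.RingMonic.rdivp_eq monP p) !rmorphD !rmorphM evP evPz !mulr0 !add0r.
set r := Pdiv.Ring.rmodp p P => r0.
(* [r] vanishes at [zeta] and has smaller degree than ['Phi_m], whose degree is that of the minimal
   polynomial of [zeta] over the rationals. *)
suff -> : r = 0 by rewrite rmorph0.
have [Q [QE monQ] dvdQ] := minCpolyP zeta.
have sizeQ : size Q = size P.
  rewrite -(size_map_poly (ratr : rat -> algC)) -QE (minCpoly_cyclotomic prim).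
  by rewrite -(Cintr_Cyclotomic prim) size_map_inj_poly ?rmorph0 //; apply: intr_inj.
apply/eqP; apply: contraT => nzr.
have : Q %| map_poly intr r.
  rewrite -dvdQ -map_poly_comp (eq_map_poly (g := intr)); last first.
    by move=> x; rewrite /= ratr_int.
  by apply/eqP.
move/dvdp_leq; rewrite -size_poly_eq0 size_map_inj_poly ?rmorph0 //;
  last exact: intr_inj.
rewrite size_poly_eq0 nzr sizeQ => /(_ isT).
by rewrite leqNgt Pdiv.Ring.ltn_rmodpN0 ?monic_neq0.
Qed.

(** The second component has the lower degree, so [a - b] stays monic. The last clause starts at
    [r = 1]: at [r = 0] this component is 0. *)
Lemma cheb_monic (R : idomainType) r :
  [/\ (cheb ('X : {poly R}) r).1 \is monic, size (cheb ('X : {poly R}) r).1 = r.+1,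
      (size (cheb ('X : {poly R}) r).2 <= r)%N
    & (0 < r)%N -> (cheb ('X : {poly R}) r).2 \is monic /\
                   size (cheb ('X : {poly R}) r).2 = r].
Proof.
elim: r => [|r [mona sza szb _]].
  by rewrite /= monic1 size_poly1 size_poly0.
rewrite chebS; move: mona sza szb; set a := _.1; set b := _.2 => mona sza szb.
have szab : size (a - b) = r.+1 by rewrite size_polyDl ?size_polyN ?sza.
have monab : a - b \is monic.
  by rewrite monicE lead_coefDl ?size_polyN ?sza // -monicE.
have monXab : 'X * (a - b) \is monic by rewrite monicMl ?monicX.
have szXab : size ('X * (a - b)) = r.+2.
  by rewrite size_monicM ?monicX ?monic_neq0 // size_polyX szab.
split=> //=; last by rewrite szab.
  by rewrite monicE lead_coefDl ?size_polyN ?sza ?szXab // -monicE.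
by rewrite size_polyDl szXab ?size_polyN ?sza.
Qed.

(** Geometric sums with denominators cleared. If [y^m = 1], the right sides vanish for [m = 2r + 1]
    and [m = 2r] respectively, which yields the roots. *)
Lemma cheb_geometric (F : fieldType) (y : F) r : y != 0 ->
  (y ^+ r * (cheb (2 + y + y^-1) r).1 * (y - 1) = y ^+ r.*2.+1 - 1) /\
  (y ^+ r * (cheb (2 + y + y^-1) r).2 * (y ^+ 2 - 1) = y * (y ^+ r.*2 - 1)).
Proof.
move=> y0; elim: r => [|r [IH1 IH2]].
  by rewrite /= double0 expr0 expr1 subrr !(mul1r, mul0r, mulr0).
rewrite chebS doubleS; move: IH1 IH2; set a := _.1; set b := _.2 => IH1 IH2 /=.
have IHb : y ^+ r.+1 * (a - b) * (y ^+ 2 - 1) = y * (y ^+ r.*2.+2 - 1).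
  transitivity (y * (y + 1) * (y ^+ r * a * (y - 1)) - y * (y ^+ r * b * (y ^+ 2 - 1))).
    by rewrite (exprS y r); ring.
  by rewrite IH1 IH2 !(exprS y _.+1) (exprS y r.*2); ring.
split=> //.
transitivity ((y + 1) / y * (y ^+ r.+1 * (a - b) * (y ^+ 2 - 1))
                - y * (y ^+ r * a * (y - 1))).
  by rewrite (exprS y r); field.
by rewrite IHb IH1 !(exprS y _.+1) (exprS y r.*2); field.
Qed.

Lemma expr1_neq0 (F : fieldType) (y : F) m : (0 < m)%N -> y ^+ m = 1 -> y != 0.
Proof.
move=> m0 ym; apply/eqP => y0; move/eqP: ym.
by rewrite y0 expr0n gtn_eqF // eq_sym oner_eq0.
Qed.

(** A monic polynomial of degree [n] is the product over [n] distinct roots; [2 n < m] makes these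
    distinct. *)
Lemma cos_prod_algC (m n : nat) (p : {poly algC}) (zeta : algC) :
    m.-primitive_root zeta -> (n.*2 < m)%N -> p \is monic -> size p = n.+1 ->
    (forall a, (0 < a <= n)%N -> root p (2 + zeta ^+ a + zeta ^- a)) ->
  p = \prod_(1 <= a < n.+1) ('X - (2 + zeta ^+ a + zeta ^- a)%:P).
Proof.
move=> prim ltnm monp szp rootp.
pose rs := [seq 2 + zeta ^+ a + zeta ^- a | a <- index_iota 1 n.+1].
have z0 := expr1_neq0 (prim_order_gt0 prim) (prim_expr_order prim).
rewrite (@all_roots_prod_XsubC _ p rs).
- by rewrite (monicP monp) scale1r big_map.
- by rewrite szp size_map size_iota subn1.
- by apply/allP => y /mapP[a]; rewrite mem_index_iota => /rootp ra ->.
rewrite uniq_rootsE map_inj_in_uniq ?iota_uniq // => a b.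
rewrite !mem_index_iota => /andP[a0 an] /andP[b0 bn] /eqP.
have za : zeta ^+ a != 0 by rewrite expf_neq0.
have zb : zeta ^+ b != 0 by rewrite expf_neq0.
rewrite -subr_eq0 => /eqP eq0.
(* This product is [zeta^(a + b)] times the difference of the two values; moreover
   [0 < a + b < m]. *)
have : (zeta ^+ a - zeta ^+ b) * (zeta ^+ (a + b) - 1) == 0.
  rewrite exprD.
  rewrite -(mulr0 (zeta ^+ a * zeta ^+ b)) -{}eq0; apply/eqP.
  by field; rewrite za zb.
rewrite mulf_eq0 !subr_eq0 -(prim_order_dvd prim) (eq_prim_root_expr prim).
case/orP => [/eqP|/dvdn_leq]; last by lia.
by rewrite !modn_small //; lia.
Qed.

(** [cheb_geometric] is applied at [y = zeta^a], where [y] differs from 1, and [y^2] too in the even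
    case. There [a = r] is left out, as [zeta^r = -1]. *)
Lemma cheb_prod_prim (m r : nat) (zeta : algC) : m.-primitive_root zeta ->
  (m = r.*2.+1 -> (cheb 'X r).1 =
     \prod_(1 <= a < r.+1) ('X - (2 + zeta ^+ a + zeta ^- a)%:P)) /\
  (m = r.*2 -> (cheb 'X r).2 =
     \prod_(1 <= a < r) ('X - (2 + zeta ^+ a + zeta ^- a)%:P)).
Proof.
move=> prim; have [mon1 sz1 _ mon2] := cheb_monic algC r.
have m0 := prim_order_gt0 prim.
have z0 := expr1_neq0 m0 (prim_expr_order prim).
have zan0 a : zeta ^+ a != 0 by rewrite expf_neq0.
have hornerC (y : algC) :
    (cheb 'X r).1.[y] = (cheb y r).1 /\ (cheb 'X r).2.[y] = (cheb y r).2.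
  have := rmorph_cheb (horner_eval y) 'X r.
  by rewrite /= /horner_eval hornerX => ->.
split=> mE.
  apply: (cos_prod_algC prim) => //; first by lia.
  move=> a /andP[a0 ar]; rewrite /root (hornerC _).1.
  have [geo _] := cheb_geometric r (zan0 a).
  move: geo; rewrite -mE (exprAC _ a m) (prim_expr_order prim) expr1n subrr.
  move/eqP; rewrite !mulf_eq0 subr_eq0 expf_eq0 (negbTE (zan0 a)) andbF /=.
  by rewrite -(prim_order_dvd prim) gtnNdvd ?orbF //; lia.
have [mon sz] := mon2 ltac:(lia); have rE : r = r.-1.+1 by lia.
rewrite [in RHS]rE; apply: (cos_prod_algC prim) => //; rewrite -?rE; first by lia.
  by [].
move=> a /andP[a0 ar]; rewrite /root (hornerC _).2.
have [_ geo] := cheb_geometric r (zan0 a).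
move: geo; rewrite -mE (exprAC _ a m) -(exprM _ a 2) muln2
  (prim_expr_order prim) expr1n subrr mulr0.
move/eqP; rewrite !mulf_eq0 subr_eq0 expf_eq0 (negbTE (zan0 a)) andbF /=.
by rewrite -(prim_order_dvd prim) gtnNdvd ?orbF //; lia.
Qed.

(** In [L] the values may coincide when the characteristic divides [m], so counting roots does not
    suffice. Both sides come from polynomials over [Z[X]], and the identity is carried over from
    [algC] coefficient by coefficient. *)
Lemma cheb_prod (L : fieldType) (m r : nat) (z : L) :
    (0 < m)%N -> root (map_poly intr (Cyclotomic m)) z ->
  (m = r.*2.+1 -> (cheb 'X r).1 =
     \prod_(1 <= a < r.+1) ('X - (2 + z ^+ a + z ^- a)%:P)) /\
  (m = r.*2 -> (cheb 'X r).2 =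
     \prod_(1 <= a < r) ('X - (2 + z ^+ a + z ^- a)%:P)).
Proof.
move=> m0 zm; have [zeta prim] := C_prim_root_exists m0.
have transfer (P Q : {poly {poly int}}) :
    map_poly (int_eval zeta) P = map_poly (int_eval zeta) Q ->
    map_poly (int_eval z) P = map_poly (int_eval z) Q.
  move=> /eqP; rewrite -subr_eq0 -rmorphB => /eqP PQ0.
  apply/eqP; rewrite -subr_eq0 -rmorphB; apply/eqP/polyP => i.
  rewrite coef_map coef0; apply: int_eval_cyclotomic prim zm _.
  by rewrite -coef_map PQ0 coef0.
have evX (R : comNzRingType) (y : R) : int_eval y 'X = y.
  by rewrite /int_eval /= /horner_eval map_polyX hornerX.
have zm1 : z ^+ m = 1.
  apply/eqP; rewrite -subr_eq0; apply/eqP.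
  have := @int_eval_cyclotomic L m zeta z ('X^m - 1) prim zm.
  by rewrite !rmorphB !rmorphXn !rmorph1 !evX (prim_expr_order prim) subrr => /(_ erefl).
(* ['X^(m - a)] stands for the inverse of ['X^a]: they have inverse values at any [y] with
   [y^m = 1]. *)
pose cosX (a : nat) : {poly int} := 2 + 'X^a + 'X^(m - a).
have ev_cos (F : fieldType) (y : F) n : (n < m)%N -> y ^+ m = 1 ->
    map_poly (int_eval y) (\prod_(1 <= a < n.+1) ('X - (cosX a)%:P))
      = \prod_(1 <= a < n.+1) ('X - (2 + y ^+ a + y ^- a)%:P).
  move=> ltnm ym; rewrite rmorph_prod big_nat [RHS]big_nat.
  apply: eq_bigr => a /andP[a0 an].
  rewrite rmorphB /= map_polyX map_polyC /=; congr (_ - (_)%:P).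
  rewrite -[LHS]/(int_eval y (cosX a)) /cosX !rmorphD !rmorphXn !evX !rmorph1.
  congr (_ + _); have ya : y ^+ a != 0 by rewrite expf_neq0 // (expr1_neq0 m0).
  by apply: (mulfI ya); rewrite [RHS]divff // -exprD subnKC // ltnW //; lia.
have ev_cheb (R : comNzRingType) (y : R) :
    cheb 'X r =
      (map_poly (int_eval y) (cheb 'X r).1, map_poly (int_eval y) (cheb 'X r).2).
  by rewrite -rmorph_cheb /= map_polyX.
have [prim1 prim2] := cheb_prod_prim r prim.
split=> mE; rewrite (ev_cheb _ z) /=.
  rewrite -ev_cos //; last by lia.
  apply: transfer; rewrite ev_cos ?(prim_expr_order prim) //; last by lia.
  by rewrite -prim1 // (ev_cheb _ zeta).
have rE : r = r.-1.+1 by lia.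
rewrite [in RHS]rE -ev_cos //; last by lia.
apply: transfer; rewrite ev_cos ?(prim_expr_order prim) //; last by lia.
by rewrite -rE -prim2 // [in RHS](ev_cheb _ zeta).
Qed.

(** * Diagonalizability *)

Section Diagonalizable.
Variables (k : fieldType) (V : vectType k).

Lemma free_subseq_span (X : seq V) :
  exists Y, [/\ free Y, {subset Y <= X} & <<Y>>%VS = <<X>>%VS].
Proof.
elim: X => [|x X [Y [freeY sYX spanY]]]; first by exists [::]; rewrite nil_free.
have [xY|xY] := boolP (x \in <<Y>>%VS).
  exists Y; split=> // [y /sYX yX|]; first by rewrite inE yX orbT.
  rewrite span_cons -spanY; apply/esym/addv_idPr.
  by rewrite -memvE.
exists (x :: Y); split; first by rewrite free_cons xY.
  by move=> y; rewrite !inE => /orP[->//|/sYX ->]; rewrite orbT.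
by rewrite !span_cons spanY.
Qed.

Variable F : 'End(V).

Definition prod_shift (rs : seq k) (v : V) : V :=
  foldr (fun l w => F w - l *: w) v rs.

Let eigensum (v : V) := exists s : seq (k * V),
  (forall p, p \in s -> F p.2 = p.1 *: p.2) /\ v = \sum_(p <- s) p.2.

(** Dividing the components of eigenvalue [a <> l] by [a - l] gives [w] such that [(F - l)(v - w)]
    is the [l]-component. So [(F - l)^2] kills [v - w], and by hypothesis [F - l] already does. *)
Let eigensum_shift l v :
  (forall w, F (F w - l *: w) = l *: (F w - l *: w) -> F w = l *: w) ->
  eigensum (F v - l *: v) -> eigensum v.
Proof.
move=> red [s [eig_s vE]].
pose w := \sum_(p <- s | p.1 != l) (p.1 - l)^-1 *: p.2.
have FwE : F w - l *: w = \sum_(p <- s | p.1 != l) p.2.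
  rewrite /w linear_sum scaler_sumr -sumrB big_seq_cond [RHS]big_seq_cond.
  apply: eq_bigr => p /andP[/eig_s Fp pl].
  rewrite linearZ /= Fp !scalerA -scalerBl [l * _]mulrC -mulrBr mulVf ?scale1r //.
  by rewrite subr_eq0.
pose u := \sum_(p <- s | p.1 == l) p.2.
have Fu : F u = l *: u.
  rewrite /u linear_sum scaler_sumr big_seq_cond [RHS]big_seq_cond.
  by apply: eq_bigr => p /andP[/eig_s Fp /eqP <-]; rewrite /= Fp.
have shift : F (v - w) - l *: (v - w) = u.
  rewrite linearB scalerBr opprD opprK addrACA [- F w + _]addrC -(opprB (F w)) FwE.
  by rewrite vE (bigID (fun p => p.1 == l)) /= addrK.
exists ((l, v - w) :: [seq (p.1, (p.1 - l)^-1 *: p.2) | p <- s & p.1 != l]).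
split; last by rewrite big_cons /= big_map big_filter subrK.
move=> p; rewrite inE => /orP[/eqP-> /=|/mapP[r]].
  by apply: red; rewrite shift.
rewrite mem_filter => /andP[_ /eig_s Fr] -> /=.
by rewrite linearZ /= Fr !scalerA mulrC.
Qed.

(** The factors [F - l] are removed one at a time by [eigensum_shift]. Repetitions in [rs] are
    harmless, since [(F - l)^2 v = 0] implies [(F - l) v = 0]. *)
Lemma ldiagonalizable_split rs :
    (forall v, prod_shift rs v = 0) ->
    (forall l v, F (F v - l *: v) = l *: (F v - l *: v) -> F v = l *: v) ->
  ldiagonalizable F.
Proof.
move=> rs0 red.
have eigsum v : eigensum v.
  have : eigensum (prod_shift rs v) by rewrite rs0; exists [::]; rewrite big_nil.
  elim: rs {rs0} => //= l rs IHrs /eigensum_shift es; apply: IHrs; apply: es.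
  exact: red.
have [X [eigX spanX]] : exists X, (forall x, x \in X -> exists a, F x = a *: x) /\
    (forall v, v \in (vbasis fullv : seq V) -> v \in <<X>>%VS).
  elim: (vbasis fullv : seq V) => [|v b [X [eigX spanX]]]; first by exists [::].
  have [s [eig_s vE]] := eigsum v.
  exists ([seq p.2 | p <- s] ++ X); split=> [x|x].
    rewrite mem_cat => /orP[/mapP[p /eig_s Fp ->]|/eigX //].
    by exists p.1.
  rewrite span_cat inE => /orP[/eqP->|/spanX xX]; last first.
    by apply: (subvP (addvSr _ _)).
  apply: (subvP (addvSl _ _)); rewrite vE big_seq; apply: rpred_sum => p ps.
  by apply/memv_span/map_f.
have [Y [freeY sYX spanY]] := free_subseq_span X.
exists Y; split=> [|y /sYX /eigX //].
rewrite /basis_of freeY spanY andbT eqEsubv subvf /=.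
by rewrite -(span_basis (vbasisP fullv)); apply/span_subvP.
Qed.

Lemma leigenvalue_split rs a :
  (forall v, prod_shift rs v = 0) -> passmx.leigenvalue F a -> a \in rs.
Proof.
move=> rs0; rewrite /passmx.leigenvalue -vpick0; set v := vpick _ => v0.
have : v \in passmx.leigenspace F a by apply: memv_pick.
rewrite memv_ker !lfun_simp /= subr_eq0 => /eqP Fv.
have prodE s : prod_shift s v = (\prod_(l <- s) (a - l)) *: v.
  elim: s => [|l s IHs]; first by rewrite big_nil scale1r.
  by rewrite big_cons /= IHs linearZ /= Fv !scalerA -scalerBl [l * _]mulrC -mulrBr mulrC.
move/eqP: (rs0 v); rewrite prodE scaler_eq0 (negbTE v0) orbF.
rewrite prodf_seq_eq0 => /hasP[l ls]; rewrite subr_eq0 => /eqP -> //.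
Qed.
End Diagonalizable.

(** * Dihedral Hecke algebras *)

Section RegularIdempotents.
Variables (k : fieldType) (A : algType k) (q : k) (m : nat) (e f : A).
Hypotheses (q0 : q != 0) (qN1 : q + 1 != 0) (ee : e * e = e) (ff : f * f = f).
Let s := (q + 1) *: e - 1.
Let t := (q + 1) *: f - 1.
Hypothesis braid : alternating m s t = alternating m t s.

(** The subalgebra generated by [e] and [f] is an image of the dihedral Hecke algebra, in which they
    come from [(sigma + 1)/(q + 1)]. *)
Lemma semisimple_regular_pair :
  semisimple_ring (hecke q (dihedral m)) -> regular_pair e f.
Proof.
move=> ss x efx; pose g b := if b then s else t.
have quad b : (g b - q%:A) * (g b + 1) = 0 by case: b; apply: idem_quadratic.
have lift_idem b : (if b then e else f) =
    free_lift g ((q + 1)^-1 *: (free_gen k b + 1)).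
  rewrite free_liftZ free_liftD free_lift_gen free_lift1.
  by case: b; rewrite /g subrK scalerA mulVf ?scale1r.
have [z ->] : exists z, x = free_lift g z.
  apply: (efx (fun x => exists z, x = free_lift g z)).
  - by exists 1; rewrite free_lift1.
  - by move=> _ _ [y ->] [z ->]; exists (y + z); rewrite free_liftD.
  - by move=> a _ [y ->]; exists (a *: y); rewrite free_liftZ.
  - by move=> _ _ [y ->] [z ->]; exists (y * z); rewrite free_liftM.
  - by eexists; apply: (lift_idem true).
  - by eexists; apply: (lift_idem false).
have [y yE] := free_lift_regular quad braid ss z.
exists (free_lift g y) => // T T1 TD TZ TM Te Tf.
apply: free_lift_ind => // b.
by case: b; rewrite /g /s /t -scaleN1r; apply: (TD); apply: (TZ).
Qed.

Definition couple_spectrum (c : nat -> k) : seq k :=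
  1 :: (if odd m then [::] else [:: 0]) ++
       [seq lambda q c a | a <- index_iota 1 (m - 1)./2.+1].

Lemma couple_spectrumP (c : nat -> k) a :
  a \in couple_spectrum c -> couple_eigenvalue m q c a.
Proof.
rewrite inE mem_cat => /or3P[/eqP->||/mapP[b]].
- exact: Or31.
- by case: ifP => // /negbT om; rewrite inE => /eqP ->; apply: Or33.
- by rewrite mem_index_iota ltnS => b1 ->; apply: Or32; exists b.
Qed.

(** [cheb_prod] splits the polynomial of [braid_annihilator] over [L]; injectivity of [map_poly h]
    brings the splitting down to [k], where the [c a] live. *)
Lemma couple_spectrum_annihilates (c : nat -> k) : (0 < m)%N ->
  four_cos_sq m c ->
  (\prod_(l <- couple_spectrum c) (e * f * e - l%:A)) * e = 0.
Proof.
move=> m0 [L [h [z [zm hc]]]].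
pose kappa := (q + 1) ^+ 2 / q.
pose xi := kappa *: (e * f * e).
have kappa0 : kappa != 0 by rewrite mulf_neq0 ?invr_eq0 ?expf_neq0.
have kappaE : kappa * (q + q^-1 + 2)^-1 = 1.
  rewrite /kappa; have -> : q + q^-1 + 2 = (q + 1) ^+ 2 / q by field.
  by rewrite divff.
have prodE n : map_poly h (\prod_(1 <= a < n) ('X - (c a)%:P)) =
    \prod_(1 <= a < n) ('X - (2 + z ^+ a + z ^- a)%:P).
  rewrite rmorph_prod; apply: eq_bigr => a _.
  by rewrite rmorphB /= map_polyX map_polyC /= hc.
have chebE r :
    cheb ('X : {poly L}) r = (map_poly h (cheb 'X r).1, map_poly h (cheb 'X r).2).
  by rewrite -rmorph_cheb /= map_polyX.
have xiE r : cheb xi r = (horner_alg xi (cheb 'X r).1, horner_alg xi (cheb 'X r).2).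
  by rewrite -rmorph_cheb /= horner_algX.
have hprod n : horner_alg xi (\prod_(1 <= a < n) ('X - (c a)%:P)) =
    kappa ^+ (n - 1) *: \prod_(1 <= a < n) (e * f * e - (lambda q c a)%:A).
  rewrite rmorph_prod /= -prodr_const_nat -scaler_prod; apply: eq_bigr => a _.
  rewrite rmorphB /= horner_algX horner_algC scalerBr scalerA /lambda.
  by rewrite mulrCA kappaE mulr1.
have lambdaE n : kappa ^+ (n - 1) *:
    \prod_(l <- [seq lambda q c a | a <- index_iota 1 n])
    (e * f * e - l%:A) = horner_alg xi (\prod_(1 <= a < n) ('X - (c a)%:P)).
  by rewrite hprod big_map.
have kn0 n : kappa ^+ n != 0 by rewrite expf_neq0.
have [odd_b even_b] := braid_annihilator q0 qN1 ee ff m./2 braid.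
have [odd_c even_c] := cheb_prod m./2 m0 zm.
have mE := odd_double_half m.
rewrite /couple_spectrum; case: ifP => om; rewrite om in mE.
  have -> : (m - 1)./2.+1 = m./2.+1 by lia.
  (* The exponent of [kappa] counts the factors [e f e - lambda], each of which becomes
     [xi - c a]. *)
  apply: (scalerI (kn0 (m./2.+1 - 1)%N)); rewrite scaler0 big_cons scale1r.
  move: (odd_b (esym mE)); rewrite -/kappa -/xi.
  suff -> : (cheb xi m./2).1 = horner_alg xi (\prod_(1 <= a < m./2.+1) ('X - (c a)%:P)).
    by rewrite -lambdaE -scalerAl -scalerAr mulrA.
  rewrite xiE /=; congr (horner_alg _ _).
  by apply: (map_poly_inj h); rewrite prodE -odd_c // chebE.
have -> : (m - 1)./2.+1 = m./2 by lia.
apply: (scalerI (kn0 (m./2 - 1)%N)).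
rewrite scaler0 /= !big_cons scale0r subr0 scale1r.
move: (even_b (esym mE)); rewrite -/kappa -/xi.
suff -> : (cheb xi m./2).2 = horner_alg xi (\prod_(1 <= a < m./2) ('X - (c a)%:P)).
  by rewrite -lambdaE -scalerAl -!scalerAr -!mulrA.
rewrite xiE /=; congr (horner_alg _ _).
by apply: (map_poly_inj h); rewrite prodE -even_c // chebE.
Qed.
End RegularIdempotents.

(** * The defining relations between the generators [sigma i] *)

Section HeckeGenerators.
Variables (k : fieldType) (I : finType) (q : k) (M : I -> I -> nat).
Local Notation H := (hecke q M).

Lemma hecke_pi_alternating n i j :
  hecke_pi q M (alternating n (free_gen k i) (free_gen k j)) =
  alternating n (sigma q M i) (sigma q M j).
Proof. by elim: n i j => [//|n IHn] i j; rewrite /= -IHn -hecke_piM. Qed.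

Lemma sigma_braid i j : i != j ->
  alternating (M i j) (sigma q M i) (sigma q M j) =
  alternating (M i j) (sigma q M j) (sigma q M i).
Proof.
move=> ij; rewrite -!hecke_pi_alternating; apply/hecke_eqP/asboolP => J _.
by apply; constructor.
Qed.

Lemma sigma_quadratic i :
  (sigma q M i - q%:A) * (sigma q M i + 1) = 0.
Proof.
have piZ a x : a *: hecke_pi q M x = hecke_pi q M (a *: x) by apply: hecke_piZ.
have pi1 : 1 = hecke_pi q M 1 by [].
have pi0 : 0 = hecke_pi q M 0 by have := piZ 0 0; rewrite !scale0r.
rewrite pi1 piZ -scaleN1r piZ /sigma -!hecke_piD [LHS]hecke_piM scaleN1r pi0.
by apply/hecke_eqP; rewrite subr0; apply/asboolP => J _; apply; constructor.
Qed.
End HeckeGenerators.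

(** * Representations *)

Section Representation.
Variables (k : fieldType) (q : k) (A : algType k).
Variables (V : vectType k) (rho : representation A V).
Hypothesis qN1 : q + 1 != 0.

Definition hecke_idem (s : A) : A := (q + 1)^-1 *: (s + 1).
Definition eigenq (s : A) : {vspace V} := passmx.leigenspace (rho s) q.
Definition eigenN1 (s : A) : {vspace V} := passmx.leigenspace (rho s) (-1).

(* [quiver_map] for two elements of an arbitrary algebra: it is convertible to
   [quiver_map rho i j] when these are [sigma i] and [sigma j]. *)
Definition eigen_map (s t : A) : 'Hom(subvs_of (eigenq s), subvs_of (eigenq t)) :=
  (linfun (vsproj (eigenq t)) \o daddv_pi (eigenq t) (eigenN1 t)
     \o linfun (@vsval k V (eigenq s)))%VF.

Local Notation p := hecke_idem.

Lemma hecke_idemE s : (q + 1) *: p s - 1 = s.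
Proof. by rewrite scalerA divff // scale1r addrK. Qed.

Lemma hecke_idem_idem s : (s - q%:A) * (s + 1) = 0 -> p s * p s = p s.
Proof.
move=> quad; have uu : (s + 1) * (s + 1) = (q + 1) *: (s + 1).
  apply/eqP; rewrite -subr_eq0 -mulr_algl -mulrBl scalerDl scale1r opprD addrACA.
  by rewrite subrr addr0 quad.
by rewrite /p -scalerAl -scalerAr uu !scalerA mulfVK.
Qed.

Lemma repE x y v : rho (x * y) v = rho x (rho y v).
Proof. by rewrite repM comp_lfunE. Qed.

Lemma rep1E v : rho 1 v = v.
Proof. by rewrite rep1 id_lfunE. Qed.

Lemma repBE x y v : rho (x - y) v = rho x v - rho y v.
Proof. by rewrite linearB /= add_lfunE opp_lfunE. Qed.

Lemma repZE a x v : rho (a *: x) v = a *: rho x v.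
Proof. by rewrite linearZ /= scale_lfunE. Qed.

Lemma mem_eigenq s v : (v \in eigenq s) = (rho (p s) v == v).
Proof.
rewrite memv_ker add_lfunE opp_lfunE scale_lfunE id_lfunE -{1}(hecke_idemE s).
rewrite repBE repZE rep1E.
have -> u : (q + 1) *: u - v - q *: v = (q + 1) *: (u - v).
  by rewrite scalerBr -addrA -opprD [(q + 1) *: v]scalerDl scale1r [v + _]addrC.
by rewrite scaler_eq0 (negbTE qN1) subr_eq0.
Qed.

Lemma mem_eigenN1 s v : (v \in eigenN1 s) = (rho (p s) v == 0).
Proof.
rewrite memv_ker add_lfunE opp_lfunE scale_lfunE id_lfunE -{1}(hecke_idemE s).
by rewrite repBE repZE rep1E scaleN1r opprK subrK scaler_eq0 (negbTE qN1).
Qed.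

(** Here [p s] fixes [p s v] and kills [v - p s v], so these are the components of [v] in the two
    eigenspaces. *)
Lemma daddv_pi_rep s v : (s - q%:A) * (s + 1) = 0 ->
  daddv_pi (eigenq s) (eigenN1 s) v = rho (p s) v.
Proof.
move=> quad.
have pP w : rho (p s) (rho (p s) w) = rho (p s) w by rewrite -repE hecke_idem_idem.
have cap0 : (eigenq s :&: eigenN1 s = 0)%VS.
  apply/eqP; rewrite -subv0; apply/subvP => w.
  rewrite memv_cap mem_eigenq mem_eigenN1 memv0 => /andP[/eqP pw /eqP pw0].
  by rewrite -pw pw0.
have piN w : w \in eigenN1 s -> daddv_pi (eigenq s) (eigenN1 s) w = 0.
  move=> wN; have := daddv_pi_add cap0 (subvP (addvSr (eigenq s) _) _ wN).
  rewrite (daddv_pi_id _ wN); last by rewrite capvC.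
  by move/eqP; rewrite -subr_eq0 addrK => /eqP.
rewrite -{1}[v](subrK (rho (p s) v)) linearD /= piN ?add0r; last first.
  by rewrite mem_eigenN1 linearB /= pP subrr.
by rewrite daddv_pi_id // mem_eigenq pP.
Qed.

Lemma vsval_eigen_map s t v : (t - q%:A) * (t + 1) = 0 ->
  vsval (eigen_map s t v) = rho (p t) (vsval v).
Proof.
move=> quad; rewrite /eigen_map !comp_lfunE !lfunE /= daddv_pi_rep // vsprojK //.
by rewrite mem_eigenq -repE hecke_idem_idem.
Qed.

Lemma rep_vsval s (v : subvs_of (eigenq s)) : rho (p s) (vsval v) = vsval v.
Proof. by apply/eqP; rewrite -mem_eigenq subvsP. Qed.

Variables s t : A.
Hypotheses (quads : (s - q%:A) * (s + 1) = 0) (quadt : (t - q%:A) * (t + 1) = 0).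
Local Notation e := (hecke_idem s).
Local Notation f := (hecke_idem t).
Hypothesis reg : regular_pair e f.

Let ee : e * e = e. Proof. exact: hecke_idem_idem. Qed.
Let ff : f * f = f. Proof. exact: hecke_idem_idem. Qed.
Let gf := (eigen_map t s \o eigen_map s t)%VF.

Lemma vsval_loop (v : subvs_of (eigenq s)) : vsval (gf v) = rho (e * f * e) (vsval v).
Proof. by rewrite comp_lfunE !vsval_eigen_map // !repE rep_vsval. Qed.

(** By [regular_compl_factor], [v - f v = (1 - f) e v] is the image under some [z] of
    [(e - e f e) v = 0]. This is the core of condition (b). *)
Lemma rep_compl_eq0 v : rho e v = v -> rho (e * f * e) v = v -> rho f v = v.
Proof.
move=> ev efev; have [z zE] := regular_compl_factor ee ff reg.
apply/esym/eqP; rewrite -subr_eq0 -{1}[v](rep1E) -repBE -{1}ev -repE zE.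
by rewrite repE repBE ev efev subrr linear0.
Qed.

Lemma loop_eq0 v : gf v = 0 -> eigen_map s t v = 0.
Proof.
move=> gf0; have [z zE] := regular_mul_factor ff reg.
apply: val_inj; rewrite /= vsval_eigen_map // -(rep_vsval v) -repE zE repE.
by rewrite -vsval_loop gf0 linear0.
Qed.

Lemma loop_reduced l v : gf (gf v - l *: v) = l *: (gf v - l *: v) -> gf v = l *: v.
Proof.
have [z zE] := regular_square_factor ee ff reg l.
have hE w : vsval (gf w - l *: w) = rho (e * f * e - l *: e) (vsval w).
  by rewrite repBE repZE rep_vsval -vsval_loop.
move=> /eqP; rewrite -subr_eq0 => /eqP hh; apply/eqP; rewrite -subr_eq0; apply/eqP.
by apply: val_inj; rewrite -[LHS]/(vsval _) hE zE !repE -!hE hh !linear0.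
Qed.

Lemma loop_prod_shift rs v :
    (\prod_(l <- rs) (e * f * e - l%:A)) * e = 0 -> prod_shift gf rs v = 0.
Proof.
move=> prod0; suff : vsval (prod_shift gf rs v) =
    rho (\prod_(l <- rs) (e * f * e - l%:A)) (vsval v).
  rewrite -(rep_vsval v) -repE prod0 linear0 zero_lfunE => v0.
  exact: val_inj.
elim: rs {prod0} => [|l rs IHrs]; first by rewrite big_nil rep1E.
by rewrite big_cons repE -IHrs repBE repZE rep1E -vsval_loop.
Qed.

(** For [v = a + b], [e v = 0] gives [a = - e b], so [v = (1 - e) f b] is the image under some [z]
    of [(f - f e f) b], which is 0 because [f v = 0]. *)
Lemma intersection_eq0 : ((eigenq s + eigenq t)
                          :&: (eigenN1 s :&: eigenN1 t))%VS = 0%VS.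
Proof.
apply/eqP; rewrite -subv0; apply/subvP => v; rewrite !memv_cap !mem_eigenN1 memv0.
case/and3P => /memv_addP[a + [b + ->]]; rewrite !mem_eigenq => /eqP ea /eqP fb.
rewrite -/e -/f in ea fb *; rewrite !linearD /= ea => /eqP e0 /eqP f0.
have aE : a = - rho e b by apply/eqP; rewrite -addr_eq0 e0.
have vE : a + b = rho ((1 - e) * f) b by rewrite repE fb repBE rep1E aE addrC.
have [z zE] := regular_compl_factor ff ee (regular_pairC reg).
rewrite vE zE repE repBE fb -{1}fb.
have -> : rho (f * e * f) b = rho f (rho e b) by rewrite !repE fb.
by move: f0; rewrite aE linearN fb addrC => ->; rewrite linear0.
Qed.

Lemma sum_full : ((eigenq s + eigenq t)
                  + (eigenN1 s :&: eigenN1 t))%VS = fullv.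
Proof.
apply/eqP; rewrite eqEsubv subvf; apply/subvP => v _.
have [z zE] := regular_factor_compl ee ff reg.
(* [u = e (v - b) + b] lies in the sum of the [q]-eigenspaces and [e u = e v]; this [b] also makes
   [f u = f v], so [v - u] lies in both [-1]-eigenspaces. *)
pose b := rho (f * z) v; pose u := rho e v + (b - rho e b).
have eu : rho e u = rho e v.
  by rewrite /u linearD linearB /= -!repE ee subrr addr0.
have fu : rho f u = rho f v.
  have : rho (f * (1 - e)) v = rho ((f - f * e * f) * z) v by rewrite zE.
  rewrite mulrBr mulr1 repBE [rho (_ * z) v]repE repBE !repE -(repE f z) -/b => fE.
  rewrite /u linearD linearB /= -[rho f b]repE {1}/b -repE mulrA ff -/b -fE.
  by rewrite repE addrC subrK.
rewrite -[v](subrK u) addrC; apply: memv_add; last first.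
  by rewrite memv_cap !mem_eigenN1 !linearB /= eu fu !subrr eqxx.
rewrite /u [b - _]addrC addrA; apply: memv_add.
  by rewrite mem_eigenq linearB /= -!repE ee.
by rewrite mem_eigenq -repE mulrA ff.
Qed.

End Representation.

Section Triples.
Variables (k : fieldType) (q : k) (A : algType k) (V : vectType k).
Variables (rho : representation A V) (s t u : A).
Hypothesis qN1 : q + 1 != 0.
Hypotheses (quads : (s - q%:A) * (s + 1) = 0) (quadt : (t - q%:A) * (t + 1) = 0).
Hypothesis quadu : (u - q%:A) * (u + 1) = 0.
Hypothesis reg : regular_pair (hecke_idem q s) (hecke_idem q t).

(** Such a [v] already lies in [eigenq t], so its component there is [v] itself. *)
Lemma eigen_map_transitive (v : subvs_of (eigenq q rho s)) :
    v \in lker ((eigen_map q rho t s \o eigen_map q rho s t) - \1)%VF ->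
  eigen_map q rho s u v = eigen_map q rho t u (eigen_map q rho s t v).
Proof.
rewrite memv_ker add_lfunE opp_lfunE id_lfunE subr_eq0 => /eqP gfv.
apply: val_inj; rewrite -[LHS]/(vsval _) -[RHS]/(vsval _) !vsval_eigen_map //.
rewrite (rep_compl_eq0 qN1 quads quadt reg) ?rep_vsval //.
by rewrite -vsval_loop // gfv.
Qed.

Lemma eigen_map_limg :
  (limg (eigen_map q rho u t - (eigen_map q rho s t \o eigen_map q rho u s))%VF
     <= limg (\1 - (eigen_map q rho s t \o eigen_map q rho t s))%VF)%VS.
Proof.
have [z zE] := regular_factor_compl (hecke_idem_idem qN1 quads)
  (hecke_idem_idem qN1 quadt) reg.
apply/subvP => _ /memv_imgP[v _ ->].
(* With [e] and [f] the idempotents of [s] and [t], the first map sends [v] to [f (1 - e) v = (f - f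
   e f) z v = (1 - f e) f z v], whence [w = f z v]. *)
pose w := vsproj (eigenq q rho t) (rho (hecke_idem q t * z) (vsval v)).
have wE : vsval w = rho (hecke_idem q t * z) (vsval v).
  by rewrite vsprojK // mem_eigenq // -repE mulrA hecke_idem_idem.
apply/memv_imgP; exists w; first exact: memvf.
apply: val_inj; rewrite -[LHS]/(vsval _) -[RHS]/(vsval _).
have valB (U : {vspace V}) (a b : subvs_of U) : vsval (a - b) = vsval a - vsval b.
  exact: linearB.
rewrite !add_lfunE !opp_lfunE id_lfunE [(_ \o eigen_map q rho u s)%VF v]comp_lfunE.
rewrite [(_ \o eigen_map q rho t s)%VF w]comp_lfunE !valB !vsval_eigen_map // wE.
rewrite -!repE -!repBE.
have -> : hecke_idem q t - hecke_idem q t * hecke_idem q s =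
    hecke_idem q t * (1 - hecke_idem q s) by rewrite mulrBr mulr1.
by rewrite zE mulrBl !mulrA.
Qed.
End Triples.

Section Couple.
Variables (k : fieldType) (q : k) (A : algType k) (m : nat) (c : nat -> k).
Variables (V : vectType k) (rho : representation A V) (s t : A).
Hypotheses (q0 : q != 0) (qN1 : q + 1 != 0) (m0 : (0 < m)%N).
Hypotheses (quads : (s - q%:A) * (s + 1) = 0) (quadt : (t - q%:A) * (t + 1) = 0).
Hypothesis braid : alternating m s t = alternating m t s.
Hypothesis ss : semisimple_ring (hecke q (dihedral m)).

Let braid_idem :
  alternating m ((q + 1) *: hecke_idem q s - 1) ((q + 1) *: hecke_idem q t - 1) =
  alternating m ((q + 1) *: hecke_idem q t - 1) ((q + 1) *: hecke_idem q s - 1).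
Proof. by rewrite !hecke_idemE. Qed.

Lemma hecke_idem_regular : regular_pair (hecke_idem q s) (hecke_idem q t).
Proof.
by apply: (semisimple_regular_pair qN1 _ _ braid_idem ss); apply: hecke_idem_idem.
Qed.

Lemma eigen_map_couple (gf := (eigen_map q rho t s \o eigen_map q rho s t)%VF) :
  four_cos_sq m c ->
  [/\ ldiagonalizable gf,
      forall x, passmx.leigenvalue gf x -> couple_eigenvalue m q c x
    & forall v, gf v = 0 -> eigen_map q rho s t v = 0].
Proof.
move=> cosc; have reg := hecke_idem_regular.
have ann := couple_spectrum_annihilates q0 qN1 (hecke_idem_idem qN1 quads)
  (hecke_idem_idem qN1 quadt) braid_idem m0 cosc.
have split0 v := loop_prod_shift (rho := rho) qN1 quads quadt v ann.
split.
- exact: (ldiagonalizable_split split0 (loop_reduced qN1 quads quadt reg)).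
- by move=> x /(leigenvalue_split split0) /couple_spectrumP.
- by move=> v; apply: (loop_eq0 qN1 quads quadt reg).
Qed.
End Couple.

Theorem theorem1p4 (k : fieldType) (I : finType) (M : I -> I -> nat) (q : k)
    (c : nat -> nat -> k) (V : vectType k)
    (rho : representation (hecke q M) V) :
  coxeter_matrix M ->
  (forall i j, i != j -> four_cos_sq (M i j) (c (M i j))) ->
  generic q M ->
  H_representation M q c (quiver_map rho) /\
  forall i j, i != j ->
    ((eigq rho i + eigq rho j) + (eigN1 rho i :&: eigN1 rho j))%VS = fullv /\
    ((eigq rho i + eigq rho j) :&: (eigN1 rho i :&: eigN1 rho j))%VS = 0%VS.
Proof.
move=> [_ Msym M2] cosM [q0 ssM].
have sq := sigma_quadratic q M.
have qN1 (i j : I) : i != j -> q + 1 != 0.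
  by move=> ij; rewrite addr_eq0 (semisimple_dihedral_neqN1 (ssM i j ij)).
have reg (i j : I) : i != j ->
    regular_pair (hecke_idem q (sigma q M i)) (hecke_idem q (sigma q M j)).
  move=> ij; exact (hecke_idem_regular (qN1 _ _ ij) (sq i) (sq j)
    (sigma_braid q M ij) (ssM _ _ ij)).
(* This treats one of the two composites of a couple; exchanging [i] and [j] gives the other. *)
have half (i j : I) (ij : i != j) :=
  eigen_map_couple rho q0 (qN1 _ _ ij) (ltnW (M2 _ _ ij)) (sq i) (sq j)
    (sigma_braid q M ij) (ssM _ _ ij) (cosM _ _ ij).
split; last first.
  move=> i j ij; split.
    exact: (sum_full rho (qN1 _ _ ij) (sq i) (sq j) (reg _ _ ij)).
  exact: (intersection_eq0 rho (qN1 _ _ ij) (sq i) (sq j) (reg _ _ ij)).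
split=> [i j ij|i j l ij jl il x|i j l ij jl il].
- have ji : j != i by rewrite eq_sym.
  have [diag1 eig1 ker1] := half _ _ ij.
  have [diag2 eig2 ker2] := half _ _ ji.
  rewrite (Msym j i) in eig2.
  exact (And4 (conj diag1 diag2) eig1 eig2 (fun _ => conj ker1 ker2)).
- exact: (eigen_map_transitive (qN1 _ _ ij) (sq i) (sq j) (sq l) (reg _ _ ij)).
- exact: (eigen_map_limg rho (sigma q M l) (qN1 _ _ ij) (sq i) (sq j) (reg _ _ ij)).
Qed.
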